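(* Let $K$ be a field, $E$ a graph, $c$ and $e$ cycles in $E$ such that there exists a path in $E$ starting at $s(c)$ and ending at $s(e)$, and let $p(x)$, $q(x)$ be basic irreducible polynomials in $K[x]$. If $c$ and $e$ are not both exclusive, then $$\dim_K\operatorname{Ext}^1_{L_K(E)}\bigl(V^p_{[c^\infty]},V^q_{[e^\infty]}\bigr)=\infty .$$
   Context: Graphs: $E=(E^0,E^1,s,r)$ is an arbitrary directed graph. A path is a sequence of edges $f_1\cdots f_n$ with $r(f_i)=s(f_{i+1})$; vertices are paths of length $0$. A cycle is a path $e=e_1\cdots e_N$ ($N\ge1$) with $r(e_N)=s(e_1)$ and $s(e_i)\ne s(e_j)$ for $i\neq j$; $s(e)=s(e_1)$. A cycle is exclusive if it is disjoint from every other cycle; equivalently, no vertex $u$ on it is the base of a cycle other than the cyclic permutation of it based at $u$. Leavitt path algebra: $L_K(E)$ is the path $K$-algebra of the double graph (add an edge $f^*$ with $s(f^* )=r(f)$, $r(f^* )=s(f)$ for each $f\in E^1$) modulo $f^*g=\delta_{f,g}r(f)$ for $f,g\in E^1$ and $v=\sum_{f\in s^{-1}(v)}ff^*$ for each $v\in E^0$ with $0<|s^{-1}(v)|<\infty$. Modules $M$ over $L_K(E)$ are left and unital: $L_K(E)M=M$; $\operatorname{Ext}^1$ is computed in this category and is a $K$-vector space. Chen module: $e^\infty$ is the infinite path $eee\cdots$; an infinite path is tail equivalent to $e^\infty$ if it equals $\lambda e^\infty$ for some finite path $\lambda$; $[e^\infty]$ is the set of such infinite paths. $V_{[e^\infty]}$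 is the vector space over the base field with basis $[e^\infty]$, with left action on $\mathfrak q=f_1f_2f_3\cdots\in[e^\infty]$: for a vertex $v$, $v\mathfrak q=\mathfrak q$ if $v=s(f_1)$ and $0$ otherwise; for an edge $f$, $f\mathfrak q=ff_1f_2\cdots$ if $r(f)=s(f_1)$ and $0$ otherwise; $f^*\mathfrak q=f_2f_3\cdots$ if $f=f_1$ and $0$ otherwise. Twisting: for $0\ne a$ in the base field, the gauge automorphism $\sigma_{e,a}$ is the algebra automorphism fixing all vertices, all edges $f\neq e_1$ and all $f^*\ne e_1^*$, and sending $e_1\mapsto ae_1$, $e_1^*\mapsto a^{-1}e_1^*$. For a left module $M$, $M^{\sigma_{e,a}}$ is $M$ as abelian group with action $\ell\star m=\sigma_{e,a}(\ell)m$. A polynomial $p(x)\in K[x]$ is basic irreducible if it is irreducible in $K[x]$, has degree $\ge2$, and $p(0)=-1$. With $K'=K[x]/\langle p(x)\rangle$ and $\overline{x}=x+\langle p(x)\rangle\ne0$, $V^p_{[e^\infty]}$ is the left $L_K(E)$-module obtained by restricting scalars from $K'$ to $K$ on the twisted left $L_{K'}(E)$-module $V^{\sigma_{e,\overline{x}}}_{[e^\infty]}$ (where $V_{[e^\infty]}$ is taken over $K'$). *)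

(* Defs.v *)
From HB Require Import structures.
From mathcomp Require Import all_boot all_order all_algebra.
From mathcomp Require Import generic_quotient finmap qpoly qfpoly boolp monalg.

Set Implicit Arguments.
Unset Strict Implicit.
Unset Printing Implicit Defensive.

Import GRing.Theory.
Local Open Scope ring_scope.
Local Open Scope quotient_scope.

(* The vector space with basis G: this is {malg K[G]}, with its operations    *)
(* locked to keep unification from computing with finitely supported maps.    *)
Definition freemod (K : fieldType) (G : choiceType) : Type := {malg K[G]}.

HB.lock Definition fm_zero (K : fieldType) (G : choiceType) : freemod K G :=
  (0 : {malg K[G]}).
HB.lock Definition fm_add (K : fieldType) (G : choiceType) (x y : freemod K G) :
  freemod K G := ((x : {malg K[G]}) + (y : {malg K[G]})).
HB.lock Definition fm_opp (K : fieldType) (G : choiceType) (x : freemod K G) :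
  freemod K G := (- (x : {malg K[G]})).
HB.lock Definition fm_scale (K : fieldType) (G : choiceType) (c : K)
  (x : freemod K G) : freemod K G := (c *: (x : {malg K[G]})).

HB.lock Definition delta (K : fieldType) (G : choiceType) (g : G) :
  freemod K G := (<< g >> : {malg K[G]}).

Definition coef (K : fieldType) (G : choiceType) (x : freemod K G) (g : G) : K :=
  (x : {malg K[G]})@_g.
Definition supp (K : fieldType) (G : choiceType) (x : freemod K G) : {fset G} :=
  msupp (x : {malg K[G]}).

Arguments fm_zero {K G}.
Arguments fm_add {K G} x y.
Arguments fm_opp {K G} x.
Arguments fm_scale {K G} c x.
Arguments delta K {G} g.

Section FreeModule.
Variables (K : fieldType) (G : choiceType).
Local Notation M := (freemod K G).

HB.instance Definition _ := Choice.copy M {malg K[G]}.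

Fact fm_addA : associative (@fm_add K G).
Proof. by rewrite unlock => x y z; apply: addrA. Qed.
Fact fm_addC : commutative (@fm_add K G).
Proof. by rewrite unlock => x y; apply: addrC. Qed.
Fact fm_add0 : left_id (@fm_zero K G) fm_add.
Proof. by rewrite !unlock => x; apply: add0r. Qed.
Fact fm_addN : left_inverse (@fm_zero K G) fm_opp fm_add.
Proof. by rewrite !unlock => x; apply: addNr. Qed.
HB.instance Definition _ :=
  GRing.isZmodule.Build M fm_addA fm_addC fm_add0 fm_addN.

Fact fm_scaleA a b (x : M) : fm_scale a (fm_scale b x) = fm_scale (a * b) x.
Proof. by rewrite unlock; apply: scalerA. Qed.
Fact fm_scale1 : left_id 1 (@fm_scale K G).
Proof. by rewrite unlock => x; apply: scale1r. Qed.
Fact fm_scaleDr : right_distributive (@fm_scale K G) fm_add.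
Proof. by move=> c x y; rewrite !unlock; apply: scalerDr. Qed.
Fact fm_scaleDl (x : M) a b : fm_scale (a + b) x = fm_add (fm_scale a x) (fm_scale b x).
Proof. by rewrite !unlock; apply: scalerDl. Qed.
HB.instance Definition _ :=
  GRing.Zmodule_isLmodule.Build K M fm_scaleA fm_scale1 fm_scaleDr fm_scaleDl.

Lemma coefP (x y : M) : coef x =1 coef y <-> x = y.
Proof. by split=> [h|-> //]; apply/malgP. Qed.

Lemma coef_linear (g : G) : linear (fun x : M => coef x g : K^o).
Proof.
move=> c x y; change (coef (fm_add (fm_scale c x) y) g = c * coef x g + coef y g).
by rewrite !unlock /coef mcoeffD mcoeffZ.
Qed.

Lemma coefD (x y : M) g : coef (x + y) g = coef x g + coef y g.
Proof. by have := coef_linear g 1 x y; rewrite !scale1r. Qed.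

Lemma coef0 g : coef (0 : M) g = 0.
Proof. by apply: (addIr (coef (0 : M) g)); rewrite -coefD !add0r. Qed.

Lemma coefZ c (x : M) g : coef (c *: x) g = c * coef x g.
Proof. by have := coef_linear g c x 0; rewrite coef0 !addr0. Qed.

Lemma coef_delta (g h : G) : coef (delta K g) h = (g == h)%:R.
Proof. by rewrite /coef unlock mcoeffU. Qed.

Lemma coef_supp (x : M) g : (g \in supp x) = (coef x g != 0).
Proof. by rewrite -mcoeff_neq0. Qed.

Lemma coef_sum (I : Type) (r : seq I) (P : pred I) (F : I -> M) g :
  coef (\sum_(i <- r | P i) F i) g = \sum_(i <- r | P i) coef (F i) g.
Proof.
by apply: (big_morph (fun x : M => coef x g)) => [x y|]; rewrite ?coefD ?coef0.
Qed.

Lemma freemodE (x : M) : x = \sum_(g <- supp x) coef x g *: delta K g.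
Proof.
apply/coefP => h; rewrite coef_sum.
under eq_bigr do rewrite coefZ coef_delta.
have [hx|hx] := boolP (h \in supp x).
  rewrite (bigD1_seq h) ?fset_uniq //= eqxx mulr1 big1 ?addr0 // => g.
  by move/negbTE => ->; rewrite mulr0.
rewrite big_seq big1 => [|g gx]; first by move: hx; rewrite coef_supp negbK => /eqP.
by case: eqP gx hx => [-> ->|]; rewrite ?mulr0.
Qed.

Lemma freemod_ind (P : M -> Prop) :
  P 0 -> (forall x y, P x -> P y -> P (x + y)) ->
  (forall c x, P x -> P (c *: x)) -> (forall g, P (delta K g)) -> forall x, P x.
Proof.
move=> P0 PD PZ PU x; rewrite (freemodE x).
by elim/big_ind: _ => // g _; apply: PZ.
Qed.

End FreeModule.

HB.lock Definition lin (K : fieldType) (G : choiceType) (V : lmodType K)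
  (phi : G -> V) (x : freemod K G) : V := \sum_(g <- supp x) coef x g *: phi g.
Arguments lin {K G V} phi x.

Section LinearExtension.
Variables (K : fieldType) (G : choiceType) (V : lmodType K) (phi : G -> V).
Local Notation M := (freemod K G).

Lemma linE (x : M) : lin phi x = \sum_(g <- supp x) coef x g *: phi g.
Proof. by rewrite unlock. Qed.

Lemma linEw (d : {fset G}) (x : M) : {subset supp x <= d} ->
  lin phi x = \sum_(g <- d) coef x g *: phi g.
Proof.
move=> sxd; rewrite linE; apply: big_fset_incl; first exact/fsubsetP.
by move=> g _; rewrite coef_supp negbK => /eqP ->; rewrite scale0r.
Qed.

Lemma lin_linear : linear (lin phi : M -> V).
Proof.
move=> c x y; pose d := fsetU (supp x) (supp y).
have sx : {subset supp x <= d} by move=> g; rewrite in_fsetU => ->.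
have sy : {subset supp y <= d} by move=> g; rewrite in_fsetU => ->; rewrite orbT.
have sxy : {subset supp (c *: x + y) <= d}.
  move=> g; apply: contraLR; rewrite in_fsetU negb_or !coef_supp !negbK.
  by rewrite coefD coefZ => /andP[/eqP-> /eqP->]; rewrite mulr0 addr0.
rewrite (linEw sx) (linEw sy) (linEw sxy) scaler_sumr -big_split /=.
by apply: eq_bigr => g _; rewrite coefD coefZ scalerDl scalerA.
Qed.

HB.instance Definition _ :=
  GRing.isLinear.Build K M V *:%R (lin phi) lin_linear.

Lemma linU g : lin phi (delta K g) = phi g.
Proof.
have sg : {subset supp (delta K g) <= [fset g]%fset}.
  move=> h; rewrite coef_supp coef_delta in_fset1.
  by case: (eqVneq h g) => // _; rewrite eqxx.
by rewrite (linEw sg) big_seq_fset1 coef_delta eqxx scale1r.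
Qed.

End LinearExtension.

Record subspace (K : fieldType) (V : lmodType K) := Subspace {
  insubspace :> V -> Prop;
  subspace0 : insubspace 0;
  subspaceD : forall x y, insubspace x -> insubspace y -> insubspace (x + y);
  subspaceZ : forall c x, insubspace x -> insubspace (c *: x) }.

Section Subspaces.
Variables (K : fieldType) (V : lmodType K) (S : subspace V).

Lemma subspaceN x : S x -> S (- x).
Proof. by move=> Sx; rewrite -scaleN1r; apply: subspaceZ. Qed.

Lemma subspaceB x y : S x -> S y -> S (x - y).
Proof. by move=> Sx Sy; apply: subspaceD => //; apply: subspaceN. Qed.

Lemma subspace_sum (I : Type) (r : seq I) (P : pred I) (F : I -> V) :
  (forall i, P i -> S (F i)) -> S (\sum_(i <- r | P i) F i).
Proof. by move=> h; elim/big_ind: _ => //; [apply: subspace0 | apply: subspaceD]. Qed.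

Record subtype := Subtype { subval : V; subvalP : `[< S subval >] }.
HB.instance Definition _ := [isSub for subval].
HB.instance Definition _ := [Choice of subtype by <:].

Lemma subvalS (u : subtype) : S (subval u). Proof. exact/asboolP/subvalP. Qed.
Definition insub_of x (Sx : S x) : subtype := Subtype (introT (asboolP _) Sx).

Definition sub_zero := insub_of (subspace0 S).
Definition sub_add u v := insub_of (subspaceD (subvalS u) (subvalS v)).
Definition sub_opp u := insub_of (subspaceN (subvalS u)).
Definition sub_scale c u := insub_of (subspaceZ c (subvalS u)).

Fact sub_addA : associative sub_add.
Proof. by move=> u v w; apply: val_inj; rewrite /= addrA. Qed.
Fact sub_addC : commutative sub_add.
Proof. by move=> u v; apply: val_inj; rewrite /= addrC. Qed.
Fact sub_add0 : left_id sub_zero sub_add.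
Proof. by move=> u; apply: val_inj; rewrite /= add0r. Qed.
Fact sub_addN : left_inverse sub_zero sub_opp sub_add.
Proof. by move=> u; apply: val_inj; rewrite /= addNr. Qed.
HB.instance Definition _ :=
  GRing.isZmodule.Build subtype sub_addA sub_addC sub_add0 sub_addN.

Fact sub_scaleA a b u : sub_scale a (sub_scale b u) = sub_scale (a * b) u.
Proof. by apply: val_inj; rewrite /= scalerA. Qed.
Fact sub_scale1 : left_id 1 sub_scale.
Proof. by move=> u; apply: val_inj; rewrite /= scale1r. Qed.
Fact sub_scaleDr : right_distributive sub_scale +%R.
Proof. by move=> c u v; apply: val_inj; rewrite /= scalerDr. Qed.
Fact sub_scaleDl u : {morph sub_scale^~ u : a b / a + b}.
Proof. by move=> a b; apply: val_inj; rewrite /= scalerDl. Qed.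
HB.instance Definition _ :=
  GRing.Zmodule_isLmodule.Build K subtype
    sub_scaleA sub_scale1 sub_scaleDr sub_scaleDl.

Definition quo_rel (x y : V) := `[< S (x - y) >].

Fact quo_rel_equiv : equiv_class_of quo_rel.
Proof.
split=> [x|x y|y x z].
- by apply/asboolP; rewrite subrr; apply: subspace0.
- by apply/asboolP/asboolP => h; rewrite -opprB; apply: subspaceN.
- move=> /asboolP xy /asboolP yz; apply/asboolP.
  by rewrite -(subrK y x) -addrA; apply: subspaceD.
Qed.
Canonical quo_equiv := EquivRelPack quo_rel_equiv.

Definition quotient := {eq_quot quo_rel}%qT.
HB.instance Definition _ := Choice.on quotient.
HB.instance Definition _ := EqQuotient.on quotient.

Definition qpi (x : V) : quotient := \pi_quotient x.
Definition qrepr (u : quotient) : V := repr u.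

Lemma qreprK u : qpi (qrepr u) = u. Proof. exact: reprK. Qed.

Lemma qpiP x y : qpi x = qpi y <-> S (x - y).
Proof. by split=> [/eqmodP/asboolP|h] //; apply/eqmodP/asboolP. Qed.

Lemma qpiK x : S (qrepr (qpi x) - x).
Proof. by apply/qpiP; rewrite qreprK. Qed.

Definition quo_add u v := qpi (qrepr u + qrepr v).
Definition quo_opp u := qpi (- qrepr u).
Definition quo_scale c u := qpi (c *: qrepr u).

Lemma quo_addE x y : quo_add (qpi x) (qpi y) = qpi (x + y).
Proof. by apply/qpiP; rewrite opprD addrACA; apply: subspaceD; apply: qpiK. Qed.
Lemma quo_oppE x : quo_opp (qpi x) = qpi (- x).
Proof. by apply/qpiP; rewrite -opprD; apply: subspaceN; apply: qpiK. Qed.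
Lemma quo_scaleE c x : quo_scale c (qpi x) = qpi (c *: x).
Proof. by apply/qpiP; rewrite -scalerBr; apply: subspaceZ; apply: qpiK. Qed.

Fact quo_addA : associative quo_add.
Proof.
move=> u v w; rewrite -[u]qreprK -[v]qreprK -[w]qreprK.
by rewrite !quo_addE addrA.
Qed.
Fact quo_addC : commutative quo_add.
Proof. by move=> u v; rewrite /quo_add addrC. Qed.
Fact quo_add0 : left_id (qpi 0) quo_add.
Proof. by move=> u; rewrite -[u]qreprK quo_addE add0r. Qed.
Fact quo_addN : left_inverse (qpi 0) quo_opp quo_add.
Proof. by move=> u; rewrite -[u]qreprK quo_oppE quo_addE addNr. Qed.
HB.instance Definition _ :=
  GRing.isZmodule.Build quotient quo_addA quo_addC quo_add0 quo_addN.

Lemma qpiD x y : qpi (x + y) = qpi x + qpi y. Proof. by rewrite -quo_addE. Qed.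

Fact quo_scaleA a b u : quo_scale a (quo_scale b u) = quo_scale (a * b) u.
Proof. by rewrite -[u]qreprK !quo_scaleE scalerA. Qed.
Fact quo_scale1 : left_id 1 quo_scale.
Proof. by move=> u; rewrite -[u]qreprK quo_scaleE scale1r. Qed.
Fact quo_scaleDr : right_distributive quo_scale +%R.
Proof.
move=> c u v; rewrite -[u]qreprK -[v]qreprK.
by rewrite -qpiD !quo_scaleE scalerDr qpiD.
Qed.
Fact quo_scaleDl u : {morph quo_scale^~ u : a b / a + b}.
Proof. by move=> a b; rewrite -[u]qreprK !quo_scaleE scalerDl qpiD. Qed.
HB.instance Definition _ :=
  GRing.Zmodule_isLmodule.Build K quotient
    quo_scaleA quo_scale1 quo_scaleDr quo_scaleDl.

Lemma qpi_linear : linear qpi.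
Proof. by move=> c x y; rewrite qpiD -quo_scaleE. Qed.
HB.instance Definition _ :=
  GRing.isLinear.Build K V quotient *:%R qpi qpi_linear.

Lemma qpi_eq0 x : qpi x = 0 <-> S x.
Proof. by rewrite -(linear0 qpi) qpiP subr0. Qed.

(* A linear map that vanishes on S factors through the quotient.              *)
Lemma qrepr_linear (W : lmodType K) (f : {linear V -> W}) :
  (forall x, S x -> f x = 0) -> linear (fun u => f (qrepr u)).
Proof.
move=> f0 c u v; rewrite -linearP; apply/eqP; rewrite -subr_eq0 -linearB.
by apply/eqP; apply: f0; apply/qpiP; rewrite qpi_linear !qreprK.
Qed.

Lemma qreprE (W : lmodType K) (f : {linear V -> W}) x :
  (forall x, S x -> f x = 0) -> f (qrepr (qpi x)) = f x.
Proof.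
move=> f0; apply/eqP; rewrite -subr_eq0 -linearB; apply/eqP; apply: f0; exact: qpiK.
Qed.

End Subspaces.

Arguments qpi {K V} S x.
Arguments qrepr {K V S} u.

Definition restrict_scalars (K F : fieldType) (i : {rmorphism K -> F})
  (V : lmodType F) : Type := V.

Section RestrictScalars.
Variables (K F : fieldType) (i : {rmorphism K -> F}) (V : lmodType F).
Local Notation W := (restrict_scalars i V).
HB.instance Definition _ := GRing.Zmodule.on W.
Definition rs_scale (c : K) (v : W) : W := i c *: (v : V).
Fact rs_scaleA a b v : rs_scale a (rs_scale b v) = rs_scale (a * b) v.
Proof. by rewrite /rs_scale scalerA rmorphM. Qed.
Fact rs_scale1 : left_id 1 rs_scale.
Proof. by move=> v; rewrite /rs_scale rmorph1 scale1r. Qed.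
Fact rs_scaleDr : right_distributive rs_scale +%R.
Proof. by move=> c u v; rewrite /rs_scale scalerDr. Qed.
Fact rs_scaleDl v : {morph rs_scale^~ v : a b / a + b}.
Proof. by move=> a b; rewrite /rs_scale rmorphD scalerDl. Qed.
HB.instance Definition _ :=
  GRing.Zmodule_isLmodule.Build K W rs_scaleA rs_scale1 rs_scaleDr rs_scaleDl.
End RestrictScalars.

(* No restriction is placed on a graph by asking for choiceTypes: under the   *)
(* axioms of boolp every type carries such a structure.                       *)
Record graph := Graph {
  vert : choiceType;
  edge : choiceType;
  src : edge -> vert;
  tgt : edge -> vert }.
Arguments src {g} _.
Arguments tgt {g} _.

Section Paths.
Variable E : graph.

Fixpoint chain (v : vert E) (s : seq (edge E)) : bool :=
  if s is f :: s' then (src f == v) && chain (tgt f) s' else true.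

(* The source is recorded because a path of length 0 is a vertex.             *)
Record gpath := GPath {
  pval : vert E * seq (edge E);
  pvalP : chain pval.1 pval.2 }.
HB.instance Definition _ := [isSub for pval].
HB.instance Definition _ := [Choice of gpath by <:].

Definition psrc (p : gpath) := (pval p).1.
Definition pedges (p : gpath) := (pval p).2.
Definition ptgt (p : gpath) := last (psrc p) (map tgt (pedges p)).

Lemma chain_cat v s t :
  chain v (s ++ t) = chain v s && chain (last v (map tgt s)) t.
Proof. by elim: s v => //= f s IH v; rewrite IH andbA. Qed.

Definition vpath (v : vert E) : gpath := @GPath (v, [::]) isT.

Fact epath_chain (f : edge E) : chain (src f, [:: f]).1 (src f, [:: f]).2.
Proof. by rewrite /= eqxx. Qed.
Definition epath (f : edge E) : gpath := GPath (epath_chain f).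

Fact pcat_chain (p q : gpath) : ptgt p = psrc q ->
  chain (psrc p, pedges p ++ pedges q).1 (psrc p, pedges p ++ pedges q).2.
Proof.
move=> h; rewrite /= chain_cat (pvalP p) /=; move: (pvalP q).
by rewrite -/(ptgt p) h.
Qed.
Definition pcat (p q : gpath) (h : ptgt p = psrc q) : gpath :=
  GPath (pcat_chain h).

Definition pcomp (p q : gpath) : option gpath :=
  if ptgt p =P psrc q is ReflectT h then Some (pcat h) else None.

Lemma pcompE (p q : gpath) (h : ptgt p = psrc q) : pcomp p q = Some (pcat h).
Proof.
rewrite /pcomp; case: eqP => // h'.
by rewrite (eq_irrelevance h h').
Qed.

Lemma pcompN (p q : gpath) : ptgt p != psrc q -> pcomp p q = None.
Proof. by rewrite /pcomp; case: eqP. Qed.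

Lemma ptgt_cat (p q : gpath) (h : ptgt p = psrc q) : ptgt (pcat h) = ptgt q.
Proof. by rewrite /ptgt /= map_cat last_cat -/(ptgt p) h. Qed.

Lemma pcompA p q r :
  obind (pcomp p) (pcomp q r) = obind (fun s => pcomp s r) (pcomp p q).
Proof.
have [h1|n1] := eqVneq (ptgt q) (psrc r); have [h2|n2] := eqVneq (ptgt p) (psrc q).
- rewrite (pcompE h1) (pcompE h2) /=.
  have h3 : ptgt p = psrc (pcat h1) by [].
  have h4 : ptgt (pcat h2) = psrc r by rewrite ptgt_cat.
  rewrite (pcompE h3) (pcompE h4); congr Some; apply: val_inj => /=.
  by rewrite /pedges /psrc /= catA.
- by rewrite (pcompE h1) (pcompN n2) /= pcompN.
- by rewrite (pcompN n1) (pcompE h2) /= pcompN // ptgt_cat.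
- by rewrite (pcompN n1) (pcompN n2).
Qed.

(* A cycle is stored as its first edge together with the remaining ones.      *)
(* path.cycle asks that consecutive edges, the last and the first included,   *)
(* be composable.                                                             *)
Definition is_cycle (s : seq (edge E)) : bool :=
  [&& s != [::], cycle (fun f g => tgt f == src g) s & uniq (map src s)].

Record gcycle := GCycle {
  chead : edge E;
  ctail : seq (edge E);
  gcycleP : is_cycle (chead :: ctail) }.

Definition cseq (c : gcycle) : seq (edge E) := chead c :: ctail c.
Definition cbase (c : gcycle) : vert E := src (chead c).

(* c is exclusive when, for each vertex u on c, the only cycle based at u is  *)
(* the cyclic permutation of c based at u.                                    *)
Definition exclusive (c : gcycle) : Prop :=
  forall u, u \in map src (cseq c) ->
  forall d : gcycle, cbase d = u ->
  cseq d = rot (index u (map src (cseq c))) (cseq c).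

End Paths.

Definition pmul1 (K : fieldType) (E : graph) (p q : gpath E) : (freemod K (gpath E)) :=
  if pcomp p q is Some r then delta K r else 0.

HB.lock Definition pamul (K : fieldType) (E : graph) (x y : (freemod K (gpath E))) :
  (freemod K (gpath E)) := lin (fun p => lin (@pmul1 K E p) y) x.
Arguments pamul {K E} x y.

Section PathAlgebra.
Variables (K : fieldType) (E : graph).
Local Notation A := (freemod K (gpath E)).

Lemma pamulE (x y : A) : pamul x y = lin (fun p => lin (@pmul1 K E p) y) x.
Proof. by rewrite unlock. Qed.

Lemma pamulUU p q : pamul (delta K p) (delta K q) = @pmul1 K E p q.
Proof. by rewrite pamulE !linU. Qed.

Lemma pamul_linl (y : A) : linear (pamul^~ y).
Proof. by move=> c x x'; rewrite !pamulE linearP. Qed.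

Lemma pamul_linr (x : A) : linear (pamul x).
Proof.
move=> c y y'; rewrite !pamulE !linE scaler_sumr -big_split /=.
apply: eq_bigr => p _; rewrite linearP scalerDr.
by rewrite !scalerA mulrC.
Qed.

HB.instance Definition _ (x : A) :=
  GRing.isLinear.Build K A A *:%R (pamul x) (pamul_linr x).

Definition pamulr (y x : A) : A := pamul x y.
HB.instance Definition _ (y : A) :=
  GRing.isLinear.Build K A A *:%R (pamulr y) (pamul_linl y).

Lemma pamul0l (y : A) : pamul 0 y = 0. Proof. exact: (linear0 (pamulr y)). Qed.
Lemma pamulDl (x x' y : A) : pamul (x + x') y = pamul x y + pamul x' y.
Proof. exact: (linearD (pamulr y)). Qed.
Lemma pamulBl (x x' y : A) : pamul (x - x') y = pamul x y - pamul x' y.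
Proof. exact: (linearB (pamulr y)). Qed.
Lemma pamulZl c (x y : A) : pamul (c *: x) y = c *: pamul x y.
Proof. exact: (linearZ_LR (pamulr y)). Qed.
Lemma pamul0r (x : A) : pamul x 0 = 0. Proof. exact: (linear0 (pamul x)). Qed.
Lemma pamulDr (x y y' : A) : pamul x (y + y') = pamul x y + pamul x y'.
Proof. exact: (linearD (pamul x)). Qed.
Lemma pamulBr (x y y' : A) : pamul x (y - y') = pamul x y - pamul x y'.
Proof. exact: (linearB (pamul x)). Qed.
Lemma pamulZr c (x y : A) : pamul x (c *: y) = c *: pamul x y.
Proof. exact: (linearZ_LR (pamul x)). Qed.

Lemma pamulA : associative (@pamul K E).
Proof.
move=> x y z; elim/freemod_ind: x => [|x x' h h'|c x h|p].
- by rewrite !pamul0l.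
- by rewrite !pamulDl h h'.
- by rewrite !pamulZl h.
elim/freemod_ind: y => [|x x' h h'|c x h|q].
- by rewrite pamul0l !pamul0r pamul0l.
- by rewrite pamulDl !pamulDr pamulDl h h'.
- by rewrite (pamulZl c x z) !pamulZr (pamulZl c _ z) h.
elim/freemod_ind: z => [|x x' h h'|c x h|r].
- by rewrite !pamul0r.
- by rewrite !pamulDr h h'.
- by rewrite !pamulZr h.
rewrite !pamulUU /pmul1; move: (pcompA p q r).
case: (pcomp q r) (pcomp p q) => [s|] [t|] /=; rewrite ?pamulUU /pmul1.
- by move=> ->.
- by move=> ->; rewrite pamul0l.
- by move=> <-; rewrite pamul0r.
- by rewrite pamul0l pamul0r.
Qed.

End PathAlgebra.

(* inl f is the edge f, and inr f the ghost edge f^*.                         *)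
Definition double (E : graph) : graph := {|
  vert := vert E;
  edge := (edge E + edge E)%type;
  src := fun g => match g with inl f => src f | inr f => tgt f end;
  tgt := fun g => match g with inl f => tgt f | inr f => src f end |}.

Section Leavitt.
Variables (K : fieldType) (E : graph).
Local Notation A := (freemod K (gpath (double E))).

Definition pa_vert (v : vert E) : A := (delta _ (@vpath (double E) v)).
Definition pa_edge (f : edge E) : A := (delta _ (@epath (double E) (inl f))).
Definition pa_ghost (f : edge E) : A := (delta _ (@epath (double E) (inr f))).

(* In CK2 the duplicate-free sequence fs enumerates s^{-1}(v), which is       *)
(* thereby finite, and it is non-empty.                                       *)
Inductive leavitt_rel : A -> Prop :=
| CK1 f g : leavitt_rel
    (pamul (pa_ghost f) (pa_edge g) - (if f == g then pa_vert (tgt f) else 0))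
| CK2 v (fs : seq (edge E)) :
    fs != [::] -> uniq fs -> (forall f, (f \in fs) = (src f == v)) ->
    leavitt_rel
      (pa_vert v - \sum_(f <- fs) pamul (pa_edge f) (pa_ghost f)).

Inductive in_leavitt_ideal : A -> Prop :=
| lid_rel x : leavitt_rel x -> in_leavitt_ideal x
| lid_0 : in_leavitt_ideal 0
| lid_D x y : in_leavitt_ideal x -> in_leavitt_ideal y -> in_leavitt_ideal (x + y)
| lid_Z c x : in_leavitt_ideal x -> in_leavitt_ideal (c *: x)
| lid_Ml x y : in_leavitt_ideal y -> in_leavitt_ideal (pamul x y)
| lid_Mr x y : in_leavitt_ideal x -> in_leavitt_ideal (pamul x y).

Definition leavitt_ideal : subspace A := Subspace lid_0 lid_D lid_Z.

Definition lpa : lmodType K := quotient leavitt_ideal.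

Definition lpa_pi (x : A) : lpa := qpi leavitt_ideal x.
Definition lpa_repr (x : lpa) : A := qrepr x.

HB.instance Definition _ :=
  GRing.isLinear.Build K A lpa *:%R lpa_pi (qpi_linear leavitt_ideal).

Definition lpa_mul (x y : lpa) : lpa := lpa_pi (pamul (lpa_repr x) (lpa_repr y)).

Lemma lpa_reprK x : lpa_pi (lpa_repr x) = x. Proof. exact: qreprK. Qed.

Lemma lpa_mulE x y : lpa_mul (lpa_pi x) (lpa_pi y) = lpa_pi (pamul x y).
Proof.
apply/qpiP; set x' := lpa_repr _; set y' := lpa_repr _.
have -> : pamul x' y' - pamul x y = pamul x' (y' - y) + pamul (x' - x) y.
  by rewrite pamulBr pamulBl addrA subrK.
by apply: lid_D; [apply: lid_Ml; exact: (qpiK leavitt_ideal y)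
               | apply: lid_Mr; exact: (qpiK leavitt_ideal x)].
Qed.

Lemma lpa_mulA : associative lpa_mul.
Proof.
move=> x y z; rewrite -(lpa_reprK x) -(lpa_reprK y) -(lpa_reprK z).
by rewrite !lpa_mulE pamulA.
Qed.

Lemma lpa_mul_linl y : linear (lpa_mul^~ y).
Proof.
move=> c x x'; rewrite -(lpa_reprK x) -(lpa_reprK x') -(lpa_reprK y) -linearP.
by rewrite !lpa_mulE -linearP pamul_linl.
Qed.

Lemma lpa_mul_linr x : linear (lpa_mul x).
Proof.
move=> c y y'; rewrite -(lpa_reprK x) -(lpa_reprK y) -(lpa_reprK y') -linearP.
by rewrite !lpa_mulE -linearP pamul_linr.
Qed.

Definition lpa_vert v : lpa := lpa_pi (pa_vert v).
Definition lpa_edge f : lpa := lpa_pi (pa_edge f).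
Definition lpa_ghost f : lpa := lpa_pi (pa_ghost f).

Definition lpa_verts (vs : seq (vert E)) : lpa := \sum_(v <- vs) lpa_vert v.

Lemma pa_vertsU (vs : seq (vert E)) (p : gpath (double E)) :
  uniq vs -> psrc p \in vs -> pamul (\sum_(v <- vs) pa_vert v) (delta _ p) = (delta _ p).
Proof.
move=> uvs pvs; rewrite -/(pamulr _ _) linear_sum /= (bigD1_seq (psrc p)) //=.
rewrite big1 => [|v vp]; rewrite /pamulr pamulUU /pmul1.
  have h : ptgt (@vpath (double E) (psrc p)) = psrc p by [].
  rewrite (pcompE h) addr0; congr (delta _ _); apply: val_inj => /=.
  by case: p {pvs h} => -[].
by rewrite pcompN.
Qed.

(* L_K(E) has local units, namely the finite sums of vertices.                *)
Lemma lpa_local_unit (s : seq lpa) :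
  exists2 vs, uniq vs & {in s, forall x, lpa_mul (lpa_verts vs) x = x}.
Proof.
pose vs := undup [seq psrc p | x <- s, p <- enum_fset (supp (lpa_repr x))].
exists vs => [|x xs]; first exact: undup_uniq.
rewrite -{1}(lpa_reprK x) /lpa_verts -linear_sum lpa_mulE -{2}(lpa_reprK x).
congr lpa_pi; rewrite [in LHS](freemodE (lpa_repr x)) [in RHS](freemodE (lpa_repr x)).
rewrite linear_sum /=; apply: eq_big_seq => p px; rewrite linearZ /=.
congr (_ *: _); apply: pa_vertsU; first exact: undup_uniq.
rewrite mem_undup; apply/allpairsPdep; exists x, p; split=> //.
Qed.

End Leavitt.

Section Modules.
Variables (K : fieldType) (E : graph).
Local Notation L := (lpa K E).

Record lpamod := Lpamod {
  carrier :> lmodType K;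
  act : L -> carrier -> carrier;
  act_linl : forall m, linear (act^~ m);
  act_linr : forall x, linear (act x);
  actM : forall x y m, act (lpa_mul x y) m = act x (act y m);
  act_unital : forall m : carrier, exists s : seq (L * carrier),
    m = \sum_(z <- s) act z.1 z.2 }.

HB.instance Definition _ (M : lpamod) x :=
  GRing.isLinear.Build K M M *:%R (@act M x) (@act_linr M x).

Definition actr (M : lpamod) (m : M) (x : L) : M := act x m.
HB.instance Definition _ (M : lpamod) (m : M) :=
  GRing.isLinear.Build K L M *:%R (@actr M m) (@act_linl M m).

Lemma act_local_unit (M : lpamod) (m : M) : exists vs, act (lpa_verts K vs) m = m.
Proof.
have [s sE] := act_unital m.
have [vs _ vsE] := lpa_local_unit (map fst s); exists vs.
rewrite {1}sE [RHS]sE linear_sum /=; apply: eq_big_seq => z zs.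
by rewrite -actM vsE // map_f.
Qed.

Fact unital_fixed (V : lmodType K) (a : L -> V -> V) m :
  (exists x, a x m = m) -> exists s : seq (L * V), m = \sum_(z <- s) a z.1 z.2.
Proof. by move=> [x xm]; exists [:: (x, m)]; rewrite big_seq1. Qed.

Record lpahom (M N : lpamod) := Lpahom {
  hom_fun :> M -> N;
  hom_linear : linear hom_fun;
  hom_act : forall x m, hom_fun (act x m) = act x (hom_fun m) }.

HB.instance Definition _ M N (f : lpahom M N) :=
  GRing.isLinear.Build K M N *:%R (hom_fun f) (hom_linear f).

Section Product.
Variables M N : lpamod.
Definition prod_act (x : L) (m : (M * N)%type) : (M * N)%type :=
  (act x m.1, act x m.2).
Fact prod_act_linl m : linear (prod_act^~ m).
Proof. by move=> c x y; congr (_, _); apply: act_linl. Qed.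
Fact prod_act_linr x : linear (prod_act x).
Proof. by move=> c m n; congr (_, _); apply: act_linr. Qed.
Fact prod_actM x y m : prod_act (lpa_mul x y) m = prod_act x (prod_act y m).
Proof. by congr (_, _); apply: actM. Qed.
Fact prod_act_unital m : exists s : seq (L * (M * N)),
  m = \sum_(z <- s) prod_act z.1 z.2.
Proof.
case: m => m n.
have [us um] := act_local_unit m; have [vs vn] := act_local_unit n.
exists [:: (lpa_verts K us, (m, 0)); (lpa_verts K vs, (0, n))].
rewrite big_cons big_seq1 /= /prod_act /= um vn !linear0.
by congr (_, _); rewrite /= ?addr0 ?add0r.
Qed.
Definition prod_mod : lpamod :=
  Lpamod prod_act_linl prod_act_linr prod_actM prod_act_unital.
End Product.

Record submodule (M : lpamod) := Submodule {
  submod_space :> subspace M;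
  submod_act : forall x m, submod_space m -> submod_space (act x m) }.

Section SubQuo.
Variables (M : lpamod) (S : submodule M).

Definition sub_act (x : L) (u : subtype S) : subtype S :=
  insub_of (submod_act x (subvalS u)).
Fact sub_act_linl u : linear (sub_act^~ u).
Proof. by move=> c x y; apply: val_inj; apply: act_linl. Qed.
Fact sub_act_linr x : linear (sub_act x).
Proof. by move=> c u v; apply: val_inj; apply: act_linr. Qed.
Fact sub_actM x y u : sub_act (lpa_mul x y) u = sub_act x (sub_act y u).
Proof. by apply: val_inj; apply: actM. Qed.
Fact sub_act_unital u : exists s : seq (L * subtype S),
  u = \sum_(z <- s) sub_act z.1 z.2.
Proof.
apply: unital_fixed; have [vs e] := act_local_unit (subval u).
by exists (lpa_verts K vs); apply: val_inj.
Qed.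
Definition sub_mod : lpamod :=
  Lpamod sub_act_linl sub_act_linr sub_actM sub_act_unital.

Definition quo_act (x : L) (u : quotient S) : quotient S :=
  qpi S (act x (qrepr u)).
Lemma quo_actE x m : quo_act x (qpi S m) = qpi S (act x m).
Proof. by apply/qpiP; rewrite -linearB; apply: submod_act; apply: qpiK. Qed.
Fact quo_act_linl u : linear (quo_act^~ u).
Proof. by move=> c x y; rewrite /quo_act act_linl linearP. Qed.
Fact quo_act_linr x : linear (quo_act x).
Proof.
move=> c u v; rewrite -[u]qreprK -[v]qreprK -linearP !quo_actE.
by rewrite act_linr linearP.
Qed.
Fact quo_actM x y u : quo_act (lpa_mul x y) u = quo_act x (quo_act y u).
Proof. by rewrite -[u]qreprK !quo_actE actM. Qed.
Fact quo_act_unital u : exists s : seq (L * quotient S),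
  u = \sum_(z <- s) quo_act z.1 z.2.
Proof.
apply: unital_fixed; rewrite -[u]qreprK.
have [vs e] := act_local_unit (qrepr u).
by exists (lpa_verts K vs); rewrite quo_actE e.
Qed.
Definition quo_mod : lpamod :=
  Lpamod quo_act_linl quo_act_linr quo_actM quo_act_unital.

End SubQuo.

(* Short exact sequences 0 -> N -> ext_mid -> M -> 0, whose classes under     *)
(* ext_equiv are the elements of Ext^1(M, N).                                 *)
Record extension (M N : lpamod) := Extension {
  ext_mid : lpamod;
  ext_inj : lpahom N ext_mid;
  ext_sur : lpahom ext_mid M;
  ext_injP : injective ext_inj;
  ext_surP : forall m, exists x, ext_sur x = m;
  ext_exact : forall x, ext_sur x = 0 <-> exists n, ext_inj n = x }.

Definition ext_equiv M N (X Y : extension M N) : Prop :=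
  exists f : lpahom (ext_mid X) (ext_mid Y),
    (forall n, f (ext_inj X n) = ext_inj Y n) /\
    (forall x, ext_sur Y (f x) = ext_sur X x).

Lemma ext_inj0 M N (X : extension M N) n : ext_sur X (ext_inj X n) = 0.
Proof. by apply/ext_exact; exists n. Qed.

Section SplitExtension.
Variables M N : lpamod.
Definition split_inj (n : N) : prod_mod N M := (n, 0).
Fact split_inj_lin : linear split_inj.
Proof. by move=> c n n'; congr (_, _); rewrite /= scaler0 addr0. Qed.
Fact split_inj_act x n : split_inj (act x n) = act x (split_inj n).
Proof. by congr (_, _); rewrite /= linear0. Qed.
Definition split_sur (z : prod_mod N M) : M := z.2.
Fact split_sur_lin : linear split_sur. Proof. by []. Qed.
Fact split_sur_act x z : split_sur (act x z) = act x (split_sur z).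
Proof. by []. Qed.
Fact split_injP : injective split_inj. Proof. by move=> n n' []. Qed.
Fact split_surP m : exists z, split_sur z = m.
Proof. by exists (0, m). Qed.
Fact split_exact z : split_sur z = 0 <-> exists n, split_inj n = z.
Proof.
by case: z => n m; split=> [/= ->|[n' [_ <-]]] //; exists n.
Qed.
Definition ext_split : extension M N :=
  @Extension M N (prod_mod N M)
    (Lpahom split_inj_lin split_inj_act) (Lpahom split_sur_lin split_sur_act)
    split_injP split_surP split_exact.
End SplitExtension.

Section Pullback.
Variables (M M' N : lpamod) (g : lpahom M' M) (X : extension M N).
Local Notation P := (prod_mod (ext_mid X) M').
Definition pb_in (z : P) : Prop := ext_sur X z.1 = g z.2.
Fact pb_in0 : pb_in 0. Proof. by rewrite /pb_in !linear0. Qed.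
Fact pb_inD x y : pb_in x -> pb_in y -> pb_in (x + y).
Proof. by move=> hx hy; rewrite /pb_in !linearD /= hx hy. Qed.
Fact pb_inZ c x : pb_in x -> pb_in (c *: x).
Proof. by move=> hx; rewrite /pb_in !linearZ /= hx. Qed.
Fact pb_in_act x z : pb_in z -> pb_in (act x z).
Proof. by move=> hx; rewrite /pb_in /= !hom_act hx. Qed.
Definition pb_sub : submodule P :=
  @Submodule P (Subspace pb_in0 pb_inD pb_inZ) pb_in_act.

Fact pb_inj_in (n : N) : pb_sub (ext_inj X n, 0).
Proof. by rewrite /= /pb_in /= ext_inj0 linear0. Qed.
Definition pb_inj (n : N) : sub_mod pb_sub := insub_of (pb_inj_in n).
Fact pb_inj_lin : linear pb_inj.
Proof.
move=> c n n'; apply: val_inj.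
by congr (_, _); rewrite /= ?hom_linear ?scaler0 ?addr0.
Qed.
Fact pb_inj_act x n : pb_inj (act x n) = act x (pb_inj n).
Proof. by apply: val_inj; congr (_, _); rewrite /= ?hom_act ?linear0. Qed.
Definition pb_sur (z : sub_mod pb_sub) : M' := (subval z).2.
Fact pb_sur_lin : linear pb_sur. Proof. by []. Qed.
Fact pb_sur_act x z : pb_sur (act x z) = act x (pb_sur z).
Proof. by []. Qed.
Fact pb_injP : injective pb_inj.
Proof. by move=> n n' /(congr1 (@subval _ _ _)) [] /ext_injP. Qed.
Fact pb_surP m : exists z, pb_sur z = m.
Proof.
have [x xm] := ext_surP X (g m).
have h : pb_sub (x, m) by [].
by exists (insub_of h).
Qed.
Fact pb_exact z : pb_sur z = 0 <-> exists n, pb_inj n = z.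
Proof.
split=> [z0|[n <-]] //; have := subvalS z; rewrite /= /pb_in.
rewrite -/(pb_sur z) z0 linear0 => /ext_exact[n nz].
exists n; apply: val_inj => /=; rewrite nz.
by rewrite -[X in (_, X)]z0 /pb_sur -surjective_pairing.
Qed.
Definition ext_pull : extension M' N :=
  @Extension M' N (sub_mod pb_sub)
    (Lpahom pb_inj_lin pb_inj_act) (Lpahom pb_sur_lin pb_sur_act)
    pb_injP pb_surP pb_exact.
End Pullback.

Section Pushout.
Variables (M N N' : lpamod) (h : lpahom N N') (X : extension M N).
Local Notation P := (prod_mod (ext_mid X) N').
Definition po_in (z : P) : Prop := exists n, z = (ext_inj X n, - h n).
Fact po_in0 : po_in 0. Proof. by exists 0; rewrite (linear0 (ext_inj X)) (linear0 h) oppr0. Qed.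
Fact po_inD x y : po_in x -> po_in y -> po_in (x + y).
Proof. by move=> [n ->] [n' ->]; exists (n + n'); rewrite !(linearD (ext_inj X), linearD h) opprD. Qed.
Fact po_inZ c x : po_in x -> po_in (c *: x).
Proof. by move=> [n ->]; exists (c *: n); rewrite !(linearZ_LR (ext_inj X), linearZ_LR h) -scalerN. Qed.
Fact po_in_act x z : po_in z -> po_in (act x z).
Proof.
by move=> [n ->]; exists (act x n); rewrite !hom_act /= /prod_act /= linearN.
Qed.
Definition po_sub : submodule P :=
  @Submodule P (Subspace po_in0 po_inD po_inZ) po_in_act.

Definition po_inj (n : N') : quo_mod po_sub := qpi po_sub ((0, n) : P).
Fact po_inj_lin : linear po_inj.
Proof.
move=> c n n'; rewrite /po_inj -linearP; congr qpi.
by congr (_, _); rewrite /= scaler0 addr0.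
Qed.
Fact po_inj_act x n : po_inj (act x n) = act x (po_inj n).
Proof.
by rewrite /= quo_actE /po_inj; congr qpi; congr (_, _); rewrite /= linear0.
Qed.
Definition po_fst (z : P) : M := ext_sur X z.1.
Fact po_fst_lin : linear po_fst.
Proof. by move=> c z z'; rewrite /po_fst /= hom_linear. Qed.
HB.instance Definition _ := GRing.isLinear.Build K P M *:%R po_fst po_fst_lin.
Fact po_fst0 z : po_sub z -> po_fst z = 0.
Proof. by move=> [n ->]; apply: ext_inj0. Qed.
Definition po_sur (u : quo_mod po_sub) : M := po_fst (qrepr u).
Fact po_sur_lin : linear po_sur. Proof. exact: (qrepr_linear po_fst0). Qed.
Lemma po_surE z : po_sur (qpi po_sub z) = po_fst z.
Proof. exact: (qreprE _ po_fst0). Qed.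
Fact po_sur_act x u : po_sur (act x u) = act x (po_sur u).
Proof. by rewrite -[u]qreprK /= quo_actE !po_surE /po_fst /= hom_act. Qed.
Fact po_injP : injective po_inj.
Proof.
move=> n n' /qpiP[k [/= e1 e2]]; apply/eqP; rewrite -subr_eq0 e2.
have -> : k = 0 by apply: (@ext_injP _ _ X); rewrite linear0 -e1 subr0.
by rewrite linear0 oppr0.
Qed.
Fact po_surP m : exists u, po_sur u = m.
Proof.
have [x xm] := ext_surP X m.
by exists (qpi po_sub ((x, 0) : P)); rewrite po_surE.
Qed.
Fact po_exact u : po_sur u = 0 <-> exists n, po_inj n = u.
Proof.
split=> [|[n <-]]; last by rewrite po_surE /po_fst /= linear0.
rewrite -[u]qreprK po_surE /po_fst; case: (qrepr u) => x n /= /ext_exact[k kx].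
exists (n + h k); apply/qpiP; exists (- k).
by congr (_, _); rewrite /= ?linearN /= ?kx ?sub0r // addrC addKr opprK.
Qed.
Definition ext_push : extension M N' :=
  @Extension M N' (quo_mod po_sub)
    (Lpahom po_inj_lin po_inj_act) (Lpahom po_sur_lin po_sur_act)
    po_injP po_surP po_exact.
End Pushout.

Section ProductExtension.
Variables (M M' N N' : lpamod) (X : extension M N) (Y : extension M' N').
Local Notation Z := (prod_mod (ext_mid X) (ext_mid Y)).
Definition pe_inj (n : prod_mod N N') : Z := (ext_inj X n.1, ext_inj Y n.2).
Fact pe_inj_lin : linear pe_inj.
Proof. by move=> c n n'; congr (_, _); apply: hom_linear. Qed.
Fact pe_inj_act x n : pe_inj (act x n) = act x (pe_inj n).
Proof. by congr (_, _); apply: hom_act. Qed.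
Definition pe_sur (z : Z) : prod_mod M M' := (ext_sur X z.1, ext_sur Y z.2).
Fact pe_sur_lin : linear pe_sur.
Proof. by move=> c n n'; congr (_, _); apply: hom_linear. Qed.
Fact pe_sur_act x z : pe_sur (act x z) = act x (pe_sur z).
Proof. by congr (_, _); apply: hom_act. Qed.
Fact pe_injP : injective pe_inj.
Proof. by move=> [a b] [a' b'] [/ext_injP/= -> /ext_injP/= ->]. Qed.
Fact pe_surP m : exists z, pe_sur z = m.
Proof.
case: m => m m'; have [x <-] := ext_surP X m; have [y <-] := ext_surP Y m'.
by exists (x, y).
Qed.
Fact pe_exact z : pe_sur z = 0 <-> exists n, pe_inj n = z.
Proof.
case: z => x y; split=> [[/ext_exact[n <-] /ext_exact[n' <-]]|[[n n'] [<- <-]]].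
  by exists (n, n').
by congr (_, _); apply: ext_inj0.
Qed.
Definition ext_prod : extension (prod_mod M M') (prod_mod N N') :=
  @Extension (prod_mod M M') (prod_mod N N') Z
    (Lpahom pe_inj_lin pe_inj_act) (Lpahom pe_sur_lin pe_sur_act)
    pe_injP pe_surP pe_exact.
End ProductExtension.

Section Operations.
Variables M N : lpamod.

Definition diag (m : M) : prod_mod M M := (m, m).
Fact diag_lin : linear diag. Proof. by []. Qed.
Fact diag_act x m : diag (act x m) = act x (diag m). Proof. by []. Qed.
Definition diag_hom := Lpahom diag_lin diag_act.

Definition codiag (n : prod_mod N N) : N := n.1 + n.2.
Fact codiag_lin : linear codiag.
Proof. by move=> c n n'; rewrite /codiag /= scalerDr addrACA. Qed.
Fact codiag_act x n : codiag (act x n) = act x (codiag n).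
Proof. by rewrite /codiag linearD. Qed.
Definition codiag_hom := Lpahom codiag_lin codiag_act.

Definition homothety (a : K) (n : N) : N := a *: n.
Fact homothety_lin a : linear (homothety a).
Proof. by move=> c n n'; rewrite /homothety scalerDr !scalerA mulrC. Qed.
Fact homothety_act a x n : homothety a (act x n) = act x (homothety a n).
Proof. by rewrite /homothety linearZ. Qed.
Definition homothety_hom a := Lpahom (homothety_lin a) (@homothety_act a).

Definition baer_sum (X Y : extension M N) : extension M N :=
  ext_push codiag_hom (ext_pull diag_hom (ext_prod X Y)).

Definition ext_scale (a : K) (X : extension M N) : extension M N :=
  ext_push (homothety_hom a) X.

Definition ext_lincomb n (a : 'I_n -> K) (xi : 'I_n -> extension M N) :
  extension M N := \big[baer_sum/ext_split M N]_(i < n) ext_scale (a i) (xi i).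

(* Equivalence classes of extensions live one universe too high to form an    *)
(* lmodType, so linear independence in Ext^1(M, N) is stated on               *)
(* representatives: sum, scaling and zero of classes are induced by baer_sum, *)
(* ext_scale and ext_split. Any map of extensions as in ext_equiv is bijective.*)
Definition ext_lin_indep n (xi : 'I_n -> extension M N) : Prop :=
  forall a : 'I_n -> K,
    ext_equiv (ext_lincomb a xi) (ext_split M N) -> forall i, a i = 0.

(* dim_K Ext^1(M, N) = oo: there are arbitrarily large independent families.  *)
Definition ext1_infinite_dim : Prop :=
  forall n, exists xi : 'I_n -> extension M N, ext_lin_indep xi.

End Operations.

End Modules.

Arguments lpamod K E : clear implicits.

Section RestrictModule.
Variables (K F : fieldType) (i : {rmorphism K -> F}) (E : graph).
Local Notation AK := (freemod K (gpath (double E))).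
Local Notation AF := (freemod F (gpath (double E))).

Definition pa_map : AK -> restrict_scalars i AF :=
  lin (fun p => (delta _ p) : restrict_scalars i AF).

HB.instance Definition _ := GRing.Linear.on pa_map.

Lemma rs_scaleE (V : lmodType F) c (v : V) :
  c *: (v : restrict_scalars i V) = i c *: v.
Proof. by []. Qed.

Lemma pa_mapU p : pa_map (delta _ p) = (delta _ p). Proof. exact: linU. Qed.

Lemma pa_map0 : pa_map 0 = (0 : AF). Proof. exact: linear0. Qed.
Lemma pa_mapD x y : pa_map (x + y) = (pa_map x : AF) + (pa_map y : AF).
Proof. exact: linearD. Qed.
Lemma pa_mapB x y : pa_map (x - y) = (pa_map x : AF) - (pa_map y : AF).
Proof. exact: linearB. Qed.
Lemma pa_mapZ c x : pa_map (c *: x) = i c *: (pa_map x : AF).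
Proof. exact: (linearZ_LR pa_map). Qed.
Lemma pa_map_sum I (r : seq I) (G : I -> AK) :
  pa_map (\sum_(k <- r) G k) = \sum_(k <- r) (pa_map (G k) : AF).
Proof. exact: linear_sum. Qed.

Lemma pa_mapM x y : pa_map (pamul x y) = pamul (pa_map x : AF) (pa_map y : AF).
Proof.
elim/freemod_ind: x => [|x x' h h'|c x h|p].
- by rewrite pamul0l !pa_map0 pamul0l.
- by rewrite pamulDl !pa_mapD h h' -pamulDl.
- by rewrite pamulZl !pa_mapZ h -pamulZl.
elim/freemod_ind: y => [|x x' h h'|c x h|q].
- by rewrite pamul0r !pa_map0 pamul0r.
- by rewrite pamulDr !pa_mapD h h' -pamulDr.
- by rewrite pamulZr !pa_mapZ h -pamulZr.
rewrite pamulUU !pa_mapU pamulUU /pmul1; case: (pcomp p q) => [r|].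
  exact: pa_mapU.
exact: pa_map0.
Qed.

Lemma pa_map_ideal x : in_leavitt_ideal x -> in_leavitt_ideal (pa_map x : AF).
Proof.
elim=> {x} [_ []|||||].
- move=> f g; rewrite pa_mapB pa_mapM !pa_mapU.
  have := lid_rel (@CK1 F E f g).
  by case: (f == g); rewrite ?pa_mapU ?pa_map0.
- move=> v fs h1 h2 h3; rewrite pa_mapB pa_map_sum pa_mapU.
  have := lid_rel (@CK2 F E v fs h1 h2 h3).
  by under [X in _ -> in_leavitt_ideal (_ - X)]eq_bigr do
    rewrite pa_mapM !pa_mapU.
- by rewrite pa_map0; apply: lid_0.
- by move=> x y _ hx _ hy; rewrite pa_mapD; apply: lid_D.
- by move=> c x _ hx; rewrite pa_mapZ; apply: lid_Z.
- by move=> x y _ hy; rewrite pa_mapM; apply: lid_Ml.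
- by move=> x y _ hx; rewrite pa_mapM; apply: lid_Mr.
Qed.

Definition lpa_map (x : lpa K E) : restrict_scalars i (lpa F E) :=
  lpa_pi (pa_map (lpa_repr x) : AF).

Lemma lpa_mapE (x : AK) : lpa_map (lpa_pi x) = lpa_pi (pa_map x : AF).
Proof.
apply/qpiP; rewrite -pa_mapB; apply: pa_map_ideal.
exact: (qpiK (leavitt_ideal K E) x).
Qed.

Lemma lpa_map_linear : linear lpa_map.
Proof.
move=> c x y; rewrite -(lpa_reprK x) -(lpa_reprK y) -linearP !lpa_mapE.
by rewrite pa_mapD pa_mapZ linearP.
Qed.

Lemma lpa_mapM x y :
  lpa_map (lpa_mul x y) = lpa_mul (lpa_map x : lpa F E) (lpa_map y : lpa F E).
Proof.
rewrite -(lpa_reprK x) -(lpa_reprK y) lpa_mulE !lpa_mapE pa_mapM.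
by rewrite lpa_mulE.
Qed.

Lemma lpa_map_vert v : lpa_map (lpa_vert K v) = lpa_vert F v.
Proof. by rewrite lpa_mapE pa_mapU. Qed.
Lemma lpa_map_edge f : lpa_map (lpa_edge K f) = lpa_edge F f.
Proof. by rewrite lpa_mapE pa_mapU. Qed.
Lemma lpa_map_ghost f : lpa_map (lpa_ghost K f) = lpa_ghost F f.
Proof. by rewrite lpa_mapE pa_mapU. Qed.

HB.instance Definition _ :=
  GRing.isLinear.Build K (lpa K E) (restrict_scalars i (lpa F E)) *:%R
    lpa_map lpa_map_linear.

Variable M : lpamod F E.
Local Notation W := (restrict_scalars i M).

Definition rs_act (x : lpa K E) (m : W) : W := act (lpa_map x : lpa F E) (m : M).
Fact rs_act_linl m : linear (rs_act^~ m).
Proof. by move=> c x y; rewrite /rs_act linearP; apply: act_linl. Qed.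
Fact rs_act_linr x : linear (rs_act x).
Proof. by move=> c m n; apply: act_linr. Qed.
Fact rs_actM x y m : rs_act (lpa_mul x y) m = rs_act x (rs_act y m).
Proof. by rewrite /rs_act lpa_mapM actM. Qed.
Fact rs_act_unital m : exists s : seq (lpa K E * W),
  m = \sum_(z <- s) rs_act z.1 z.2.
Proof.
apply: unital_fixed; have [vs e] := act_local_unit (m : M).
exists (lpa_verts K vs); rewrite /rs_act /lpa_verts linear_sum /=.
by under eq_bigr do rewrite lpa_map_vert.
Qed.
Definition restrict_mod : lpamod K E :=
  Lpamod rs_act_linl rs_act_linr rs_actM rs_act_unital.

End RestrictModule.

Section Gauge.
Variables (F : fieldType) (E : graph) (e1 : edge E) (a : F).
Local Notation A := (freemod F (gpath (double E))).

Definition gauge_weight (g : edge (double E)) : F :=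
  match g with
  | inl f => if f == e1 then a else 1
  | inr f => if f == e1 then a^-1 else 1
  end.

(* The algebra endomorphism fixing the vertices and scaling each edge g of    *)
(* the double graph by gauge_weight g scales a path by the product of the     *)
(* weights of its edges.                                                      *)
Definition pa_gauge : A -> A :=
  lin (fun p => (\prod_(g <- pedges p) gauge_weight g) *: (delta _ p)).
HB.instance Definition _ := GRing.Linear.on pa_gauge.

Lemma pa_gaugeU p :
  pa_gauge (delta _ p) = (\prod_(g <- pedges p) gauge_weight g) *: (delta _ p).
Proof. exact: linU. Qed.

Lemma pa_gauge0 : pa_gauge 0 = 0. Proof. exact: linear0. Qed.
Lemma pa_gaugeD x y : pa_gauge (x + y) = pa_gauge x + pa_gauge y.
Proof. exact: linearD. Qed.
Lemma pa_gaugeB x y : pa_gauge (x - y) = pa_gauge x - pa_gauge y.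
Proof. exact: linearB. Qed.
Lemma pa_gaugeZ c x : pa_gauge (c *: x) = c *: pa_gauge x.
Proof. exact: (linearZ_LR pa_gauge). Qed.
Lemma pa_gauge_sum I (r : seq I) (G : I -> A) :
  pa_gauge (\sum_(k <- r) G k) = \sum_(k <- r) pa_gauge (G k).
Proof. exact: linear_sum. Qed.

Lemma pa_gaugeM x y : pa_gauge (pamul x y) = pamul (pa_gauge x) (pa_gauge y).
Proof.
elim/freemod_ind: x => [|x x' h h'|c x h|p].
- by rewrite pamul0l !pa_gauge0 pamul0l.
- by rewrite pamulDl !pa_gaugeD h h' -pamulDl.
- by rewrite pamulZl !pa_gaugeZ h -pamulZl.
elim/freemod_ind: y => [|x x' h h'|c x h|q].
- by rewrite pamul0r !pa_gauge0 pamul0r.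
- by rewrite pamulDr !pa_gaugeD h h' -pamulDr.
- by rewrite pamulZr !pa_gaugeZ h -pamulZr.
rewrite !pa_gaugeU pamulZl pamulZr !pamulUU /pmul1.
have [h|n] := eqVneq (ptgt p) (psrc q); last first.
  by rewrite (pcompN n) pa_gauge0 !scaler0.
by rewrite (pcompE h) pa_gaugeU scalerA -big_cat.
Qed.

Lemma pa_gauge_vert v : pa_gauge (pa_vert F v) = pa_vert F v.
Proof. by rewrite pa_gaugeU big_nil scale1r. Qed.
Lemma pa_gauge_edge f :
  pa_gauge (pa_edge F f) = (if f == e1 then a else 1) *: pa_edge F f.
Proof. by rewrite pa_gaugeU big_seq1. Qed.
Lemma pa_gauge_ghost f :
  pa_gauge (pa_ghost F f) = (if f == e1 then a^-1 else 1) *: pa_ghost F f.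
Proof. by rewrite pa_gaugeU big_seq1. Qed.

Hypothesis a0 : a != 0.

Lemma pa_gauge_ideal x : in_leavitt_ideal x -> in_leavitt_ideal (pa_gauge x).
Proof.
elim=> {x} [_ []|||||].
- move=> f g; rewrite pa_gaugeB pa_gaugeM pa_gauge_ghost pa_gauge_edge.
  rewrite pamulZl pamulZr scalerA; have := lid_rel (@CK1 F E f g).
  have [<-|fg] := eqVneq f g.
    rewrite pa_gauge_vert; suff -> : (if f == e1 then a^-1 else 1) *
      (if f == e1 then a else 1) = 1 by rewrite scale1r.
    by case: eqP; rewrite ?mulVf ?mul1r.
  by rewrite pa_gauge0 !subr0 => h; apply: lid_Z.
- move=> v fs h1 h2 h3; rewrite pa_gaugeB pa_gauge_sum pa_gauge_vert.
  have := lid_rel (@CK2 F E v fs h1 h2 h3); congr (in_leavitt_ideal (_ - _)).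
  apply: eq_bigr => f _; rewrite pa_gaugeM pa_gauge_ghost pa_gauge_edge.
  rewrite pamulZl pamulZr scalerA.
  suff -> : (if f == e1 then a else 1) * (if f == e1 then a^-1 else 1) = 1.
    by rewrite scale1r.
  by case: eqP; rewrite ?divff ?mul1r.
- by rewrite pa_gauge0; apply: lid_0.
- by move=> x y _ hx _ hy; rewrite pa_gaugeD; apply: lid_D.
- by move=> c x _ hx; rewrite pa_gaugeZ; apply: lid_Z.
- by move=> x y _ hy; rewrite pa_gaugeM; apply: lid_Ml.
- by move=> x y _ hx; rewrite pa_gaugeM; apply: lid_Mr.
Qed.

Definition gauge (x : lpa F E) : lpa F E := lpa_pi (pa_gauge (lpa_repr x)).

Lemma gaugeE (x : A) : gauge (lpa_pi x) = lpa_pi (pa_gauge x).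
Proof.
apply/qpiP; rewrite -linearB; apply: pa_gauge_ideal.
exact: (qpiK (leavitt_ideal F E) x).
Qed.

Lemma gauge_linear : linear gauge.
Proof.
move=> c x y; rewrite -(lpa_reprK x) -(lpa_reprK y) -linearP !gaugeE.
by rewrite pa_gaugeD pa_gaugeZ linearP.
Qed.
HB.instance Definition _ :=
  GRing.isLinear.Build F (lpa F E) (lpa F E) *:%R gauge gauge_linear.

Lemma gaugeM x y : gauge (lpa_mul x y) = lpa_mul (gauge x) (gauge y).
Proof.
rewrite -(lpa_reprK x) -(lpa_reprK y) lpa_mulE !gaugeE pa_gaugeM.
by rewrite lpa_mulE.
Qed.

Lemma gauge_vert v : gauge (lpa_vert F v) = lpa_vert F v.
Proof. by rewrite gaugeE pa_gauge_vert. Qed.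
Lemma gauge_edge f :
  gauge (lpa_edge F f) = (if f == e1 then a else 1) *: lpa_edge F f.
Proof. by rewrite gaugeE pa_gauge_edge linearZ. Qed.
Lemma gauge_ghost f :
  gauge (lpa_ghost F f) = (if f == e1 then a^-1 else 1) *: lpa_ghost F f.
Proof. by rewrite gaugeE pa_gauge_ghost linearZ. Qed.

Variable M : lpamod F E.

Definition twist_act (x : lpa F E) (m : M) : M := act (gauge x) m.
Fact twist_act_linl m : linear (twist_act^~ m).
Proof. by move=> c x y; rewrite /twist_act linearP; apply: act_linl. Qed.
Fact twist_act_linr x : linear (twist_act x).
Proof. by move=> c m n; apply: act_linr. Qed.
Fact twist_actM x y m : twist_act (lpa_mul x y) m = twist_act x (twist_act y m).
Proof. by rewrite /twist_act gaugeM actM. Qed.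
Fact twist_act_unital m : exists s : seq (lpa F E * M),
  m = \sum_(z <- s) twist_act z.1 z.2.
Proof.
apply: unital_fixed; have [vs e] := act_local_unit m.
exists (lpa_verts F vs); rewrite /twist_act /lpa_verts linear_sum /=.
by under eq_bigr do rewrite gauge_vert.
Qed.
Definition twist : lpamod F E :=
  Lpamod twist_act_linl twist_act_linr twist_actM twist_act_unital.

End Gauge.

Section Chen.
Variables (F : fieldType) (E : graph) (e : gcycle E).
Local Notation A := (freemod F (gpath (double E))).

(* Infinite paths are sequences nat -> edge E. All elements of tail_class are *)
(* composable, see tail_chain below.                                          *)
Definition einf : nat -> edge E :=
  fun k => nth (chead e) (cseq e) (k %% size (cseq e))%N.

Definition inf_cat (s : seq (edge E)) (q : nat -> edge E) : nat -> edge E :=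
  fun k => if (k < size s)%N then nth (chead e) s k else q (k - size s)%N.

Definition tail_eq (q : nat -> edge E) : Prop :=
  exists l : gpath E, ptgt l = cbase e /\ q = inf_cat (pedges l) einf.

Record tail_class := TailClass { tval : nat -> edge E; tvalP : `[< tail_eq tval >] }.
HB.instance Definition _ := [isSub for tval].
HB.instance Definition _ := [Choice of tail_class by <:].

Lemma tvalE (q : tail_class) : tail_eq (tval q). Proof. exact/asboolP/tvalP. Qed.

Definition tsrc (q : tail_class) : vert E := src (tval q 0).

Definition inf_cons (f : edge E) (q : nat -> edge E) : nat -> edge E :=
  fun k => if k is k'.+1 then q k' else f.
Definition inf_shift (q : nat -> edge E) : nat -> edge E := fun k => q k.+1.

Lemma einf0 : einf 0 = chead e. Proof. by rewrite /einf mod0n. Qed.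

Lemma einf_chain k : tgt (einf k) = src (einf k.+1).
Proof.
rewrite /einf; set n := size (cseq e).
have n0 : (0 < n)%N by [].
have /and3P[_ /= cyc _] := gcycleP e.
move/(pathP (chead e)): cyc => cyc.
have := ltn_pmod k n0; set j := (k %% n)%N => jn.
have {cyc} := cyc j; rewrite size_rcons => /(_ jn) /eqP.
have -> : nth (chead e) (chead e :: rcons (ctail e) (chead e)) j
        = nth (chead e) (cseq e) j.
  by rewrite -rcons_cons nth_rcons -/(cseq e) -/n jn.
move=> ->; congr src; rewrite nth_rcons.
have -> : (k.+1 %% n = j.+1 %% n)%N by rewrite -(addn1 k) -(addn1 j) modnDml.
move: jn; rewrite leq_eqVlt => /orP[/eqP jn|jn].
  have [h1 h2] : (j = size (ctail e)) /\ (j.+1 = n) by split=> //; case: jn.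
  by rewrite h2 modnn h1 ltnn eqxx.
have jt : (j < size (ctail e))%N by [].
by rewrite jt modn_small.
Qed.

Lemma tail_chain (q : tail_class) k : tgt (tval q k) = src (tval q k.+1).
Proof.
have [l [le ->]] := tvalE q; case: l le => -[v s] /= cs; rewrite /ptgt /psrc /=.
elim: s v cs k => [|f s IH] v /= cs k le.
  by rewrite /inf_cat /= !subn0; apply: einf_chain.
have /andP[_ cs'] := cs.
case: k => [|k]; last first.
  by have := IH (tgt f) cs' k le; rewrite /inf_cat /= !ltnS !subSS.
rewrite /inf_cat /=; case: s le cs' {IH cs} => [|g s] /= le cs'.
  by rewrite einf0.
by case/andP: cs' => /eqP.
Qed.

Fact inf_cons_tail (f : edge E) (q : tail_class) : tgt f = tsrc q ->
  `[< tail_eq (inf_cons f (tval q)) >].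
Proof.
have [l [le qE]] := tvalE q; rewrite /tsrc qE => fq; apply/asboolP.
have fl : tgt f = psrc l.
  rewrite fq; case: l le {qE fq} => -[v [|g s]] /= c.
    by rewrite /inf_cat /= subn0 einf0 /ptgt /= => ->.
  by move=> _; rewrite /psrc /inf_cat /=; case/andP: (c) => /eqP.
have h : ptgt (epath f) = psrc l by [].
exists (pcat h); split; first by rewrite ptgt_cat.
by apply/funext => -[|k].
Qed.
Definition tcons f q (h : tgt f = tsrc q) : tail_class :=
  TailClass (inf_cons_tail h).

Fact inf_shift_tail (q : tail_class) : `[< tail_eq (inf_shift (tval q)) >].
Proof.
have [l [le qE]] := tvalE q; apply/asboolP; rewrite qE.
case: l le {qE} => -[v [|g s]] /= c; rewrite /ptgt /psrc /= => le.
  have cyc : chain (tgt (chead e)) (ctail e).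
    have /and3P[_ + _] := gcycleP e => /=; rewrite rcons_path => /andP[+ _].
    by elim: (ctail e) (chead e) => //= g s IH f /andP[/eqP-> /IH ->]; rewrite eqxx.
  exists (@GPath E (tgt (chead e), ctail e) cyc); split.
    rewrite /ptgt /psrc /=; have /and3P[_ + _] := gcycleP e => /=.
    by rewrite rcons_path last_map => /andP[_ /eqP].
  apply/funext => k; rewrite /inf_shift /inf_cat /pedges /= subn0.
  case: ltnP => kn.
    by rewrite /einf modn_small.
  rewrite /einf /=; have -> : k.+1 = (k - size (ctail e) + (size (ctail e)).+1)%N.
    by rewrite addnS subnK.
  by rewrite modnDr.
have /andP[_ c'] := c.
exists (@GPath E (tgt g, s) c'); split => //.
Qed.
Definition tshift (q : tail_class) : tail_class := TailClass (inf_shift_tail q).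

(* None stands for the result 0.                                              *)
Definition step (g : edge (double E)) (q : tail_class) : option tail_class :=
  match g with
  | inl f => if tgt f =P tsrc q is ReflectT h then Some (tcons h) else None
  | inr f => if f == tval q 0 then Some (tshift q) else None
  end.

Definition vstep (v : vert E) (q : tail_class) : option tail_class :=
  if v == tsrc q then Some q else None.

(* A path v g_1 ... g_n in the double graph, with source v, acts as the       *)
(* composite of the actions of v, g_1, ..., g_n.                              *)
Definition path_step (p : gpath (double E)) (q : tail_class) : option tail_class :=
  obind (vstep (psrc p)) (foldr (fun g => obind (step g)) (Some q) (pedges p)).

Definition path_act (p : gpath (double E)) (q : tail_class) : (freemod F tail_class) :=
  if path_step p q is Some q' then (delta _ q') else 0.

Definition pa_act (x : A) (m : (freemod F tail_class)) : (freemod F tail_class) :=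
  lin (fun p => lin (path_act p) m) x.

Lemma pa_actUU p q : pa_act (delta _ p) (delta _ q) = path_act p q.
Proof. by rewrite /pa_act !linU. Qed.

Lemma pa_act_linl m : linear (pa_act^~ m).
Proof. by move=> c x x'; rewrite /pa_act linearP. Qed.

Lemma pa_act_linr x : linear (pa_act x).
Proof.
move=> c y y'; rewrite /pa_act !linE scaler_sumr -big_split /=.
apply: eq_bigr => p _; rewrite linearP scalerDr.
by rewrite !scalerA mulrC.
Qed.
HB.instance Definition _ x :=
  GRing.isLinear.Build F (freemod F tail_class) (freemod F tail_class) *:%R
    (pa_act x) (pa_act_linr x).
Definition pa_actr m x := pa_act x m.
HB.instance Definition _ m :=
  GRing.isLinear.Build F A (freemod F tail_class) *:%R (pa_actr m) (pa_act_linl m).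

Lemma pa_act0l m : pa_act 0 m = 0. Proof. exact: (linear0 (pa_actr m)). Qed.
Lemma pa_actDl x y m : pa_act (x + y) m = pa_act x m + pa_act y m.
Proof. exact: (linearD (pa_actr m)). Qed.
Lemma pa_actBl x y m : pa_act (x - y) m = pa_act x m - pa_act y m.
Proof. exact: (linearB (pa_actr m)). Qed.
Lemma pa_actZl c x m : pa_act (c *: x) m = c *: pa_act x m.
Proof. exact: (linearZ_LR (pa_actr m)). Qed.
Lemma pa_act_suml I (r : seq I) (G : I -> A) m :
  pa_act (\sum_(k <- r) G k) m = \sum_(k <- r) pa_act (G k) m.
Proof. exact: (linear_sum (pa_actr m)). Qed.

Lemma pa_act0r x : pa_act x 0 = 0. Proof. exact: linear0. Qed.
Lemma pa_actDr x m m' : pa_act x (m + m') = pa_act x m + pa_act x m'.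
Proof. exact: linearD. Qed.
Lemma pa_actZr c x m : pa_act x (c *: m) = c *: pa_act x m.
Proof. exact: (linearZ_LR (pa_act x)). Qed.

Lemma step_src g q q' : step g q = Some q' ->
  tsrc q = tgt g /\ tsrc q' = src g.
Proof.
case: g => f /=; first by case: eqP => // h [<-].
case: eqP => // -> [<-]; split=> //.
by rewrite /tsrc /= /inf_shift -tail_chain.
Qed.

Lemma foldr_None (s : seq (edge (double E))) :
  foldr (fun g => obind (step g)) None s = None.
Proof. by elim: s => //= g s ->. Qed.

Lemma foldr_src (v : vert E) (s : seq (edge (double E))) (q q' : tail_class) :
  @chain (double E) v s ->
  obind (vstep v) (foldr (fun g => obind (step g)) (Some q) s) = Some q' ->
  tsrc q = last v (map (@tgt (double E)) s) /\ tsrc q' = v.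
Proof.
elim: s v q' => [|g s IH] v q' /=.
  by move=> _; rewrite /vstep; case: eqP => // -> [<-].
case/andP => /eqP gv cs.
case sE: (foldr _ _ _) => [q1|] //=.
case gE: (step g q1) => [q2|] //=; have [h1 h2] := step_src gE.
rewrite /vstep; case: eqP => // h [<-].
by have [] := IH (tgt g) q1 cs; rewrite ?sE /vstep /= ?h1 ?eqxx // h2 gv.
Qed.

Lemma path_step_src p q q' : path_step p q = Some q' ->
  tsrc q = ptgt p /\ tsrc q' = psrc p.
Proof. exact: (foldr_src (pvalP p)). Qed.

Lemma path_step_cat p p' (h : ptgt p = psrc p') q :
  path_step (pcat h) q = obind (path_step p) (path_step p' q).
Proof.
rewrite {1}/path_step {1}/pedges /= foldr_cat {2}/path_step -/(pedges p) -/(pedges p').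
case: (foldr _ (Some q) (pedges p')) => [q'|] /=; last by rewrite foldr_None.
rewrite /vstep; case: eqP => // n.
have: path_step p q' = None; last by [].
case E' : (path_step p q') => [q2|] //; case: n.
by have [-> _] := path_step_src E'.
Qed.

Lemma pa_actM x y m : pa_act (pamul x y) m = pa_act x (pa_act y m).
Proof.
elim/freemod_ind: m => [|m m' h h'|c m h|q]; first by rewrite !pa_act0r.
- by rewrite !pa_actDr h h'.
- by rewrite !pa_actZr h.
elim/freemod_ind: x => [|x x' h h'|c x h|p].
- by rewrite pamul0l !pa_act0l.
- by rewrite pamulDl !pa_actDl h h'.
- by rewrite pamulZl !pa_actZl h.
elim/freemod_ind: y => [|x x' h h'|c x h|p'].
- by rewrite pamul0r !pa_act0l pa_act0r.
- by rewrite pamulDr !pa_actDl pa_actDr h h'.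
- by rewrite pamulZr !pa_actZl pa_actZr h.
rewrite pamulUU /pmul1 pa_actUU /path_act.
have [h|n] := eqVneq (ptgt p) (psrc p').
  rewrite (pcompE h) pa_actUU /path_act path_step_cat.
  case: (path_step p' q) => [q'|] /=; first by rewrite pa_actUU.
  by rewrite pa_act0r.
rewrite (pcompN n) pa_act0l; case qE: (path_step p' q) => [q'|]; last first.
  by rewrite pa_act0r.
rewrite pa_actUU /path_act; case qE' : (path_step p q') => [q2|] //.
have [_ e1] := path_step_src qE; have [e2 _] := path_step_src qE'.
by rewrite -e2 -e1 eqxx in n.
Qed.

Lemma pa_act_vert v q :
  pa_act (pa_vert F v) (delta _ q) = if v == tsrc q then (delta _ q) else 0.
Proof.
by rewrite pa_actUU /path_act /path_step /= /vstep; case: eqP.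
Qed.

Lemma pa_act_step g q : pa_act (delta _ (@epath (double E) g)) (delta _ q) =
  if step g q is Some q' then (delta _ q') else 0.
Proof.
rewrite pa_actUU /path_act /path_step /= /vstep.
case sE: (step g q) => [q'|] //=; have [_ ->] := step_src sE.
by rewrite /psrc /= eqxx.
Qed.

Lemma tcons_shift (q : tail_class) (h : tgt (tval q 0) = tsrc (tshift q)) :
  tcons h = q.
Proof. by apply: val_inj; apply/funext => -[|k]. Qed.

Lemma tshift_cons f q (h : tgt f = tsrc q) : tshift (tcons h) = q.
Proof. by apply: val_inj. Qed.

Lemma pa_act_ideal x : in_leavitt_ideal x -> forall m, pa_act x m = 0.
Proof.
elim=> {x} [_ []||x y _ hx _ hy|c x _ hx|x y _ hy|x y _ hx] => [f g|v fs n0 ufs fsP|||||] m.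
- elim/freemod_ind: m => [|m m' h h'|c m h|q]; first by rewrite pa_act0r.
  + by rewrite pa_actDr h h' addr0.
  + by rewrite pa_actZr h scaler0.
  rewrite pa_actBl pa_actM pa_act_step /=.
  case: eqP => [h|n]; last first.
    rewrite pa_act0r; have [fg|_] := eqVneq f g; last by rewrite pa_act0l subrr.
    by rewrite pa_act_vert fg; case: eqP => // _; rewrite subrr.
  rewrite pa_act_step /=; have [fg|_] := eqVneq f g.
    by rewrite tshift_cons pa_act_vert -h fg eqxx subrr.
  by rewrite pa_act0l subrr.
- elim/freemod_ind: m => [|m m' h h'|c m h|q]; first by rewrite pa_act0r.
  + by rewrite pa_actDr h h' addr0.
  + by rewrite pa_actZr h scaler0.
  rewrite pa_actBl pa_act_vert pa_act_suml.
  pose G f := if f == tval q 0 then (delta _ q) else 0 : (freemod F tail_class).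
  rewrite (eq_bigr G) => [|f _]; last first.
    rewrite pa_actM pa_act_step /= /G; case: eqP => [->|_]; last exact: pa_act0r.
    rewrite pa_act_step /=; case: eqP => [h|[]]; first by rewrite tcons_shift.
    by rewrite /tsrc /= /inf_shift -tail_chain.
  have [vq|vq] := eqVneq v (tsrc q).
    rewrite (bigD1_seq (tval q 0)) ?fsP //=; last by rewrite vq.
    by rewrite big1 /G ?eqxx ?addr0 ?subrr // => f /negbTE ->.
  rewrite big_seq big1 ?subrr // => f; rewrite fsP /G => /eqP fv.
  by case: eqP => // fq; rewrite -fv fq eqxx in vq.
- exact: pa_act0l.
- by rewrite pa_actDl hx hy addr0.
- by rewrite pa_actZl hx scaler0.
- by rewrite pa_actM hy pa_act0r.
- by rewrite pa_actM hx.
Qed.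

Definition chen_act (x : lpa F E) (m : (freemod F tail_class)) :
  (freemod F tail_class) := pa_act (lpa_repr x) m.

Lemma chen_actE (x : A) m : chen_act (lpa_pi x) m = pa_act x m.
Proof.
by apply: (qreprE (f := pa_actr m)) => y /pa_act_ideal; apply.
Qed.

Fact chen_act_linl m : linear (chen_act^~ m).
Proof.
by apply: (qrepr_linear (f := pa_actr m)) => y /pa_act_ideal; apply.
Qed.
Fact chen_act_linr x : linear (chen_act x).
Proof. exact: pa_act_linr. Qed.
Fact chen_actM x y m : chen_act (lpa_mul x y) m = chen_act x (chen_act y m).
Proof. by rewrite chen_actE pa_actM. Qed.
Fact chen_act_unital m : exists s : seq (lpa F E * (freemod F tail_class)),
  m = \sum_(z <- s) chen_act z.1 z.2.
Proof.
elim/freemod_ind: m => [|m m' [s sE] [s' sE']|c m [s sE]|q].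
- by exists [::]; rewrite big_nil.
- by exists (s ++ s'); rewrite big_cat /= -sE -sE'.
- exists [seq (z.1, c *: z.2) | z <- s]; rewrite big_map {1}sE scaler_sumr.
  by apply: eq_bigr => z _; rewrite /= /chen_act linearZ.
exists [:: (lpa_vert F (tsrc q), (delta _ q))].
by rewrite big_seq1 chen_actE pa_act_vert eqxx.
Qed.

Definition chen : lpamod F E :=
  Lpamod chen_act_linl chen_act_linr chen_actM chen_act_unital.

Lemma chen_vert v q :
  act (lpa_vert F v) ((delta _ q) : chen) = if v == tsrc q then (delta _ q) else 0.
Proof. by rewrite /= chen_actE pa_act_vert. Qed.
Lemma chen_edge f q : act (lpa_edge F f) ((delta _ q) : chen) =
  if tgt f =P tsrc q is ReflectT h then (delta _ (tcons h)) else 0.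
Proof. by rewrite /= chen_actE pa_act_step /=; case: eqP. Qed.
Lemma chen_ghost f q : act (lpa_ghost F f) ((delta _ q) : chen) =
  if f == tval q 0 then (delta _ (tshift q)) else 0.
Proof. by rewrite /= chen_actE pa_act_step /=; case: eqP. Qed.

End Chen.

Section TwistedChen.
Variables (K : fieldType).

Record basic_irreducible (p : {poly K}) : Prop := BasicIrreducible {
  bi_irr : irreducible_poly p;
  bi_deg : (2 <= (size p).-1)%N;
  bi_const : p.[0] = -1 }.

(* The library forms K[x]/<h> for monic h only; p and its monic associate     *)
(* generate the same ideal.                                                   *)
Definition monic_assoc (p : {poly K}) : {poly K} := (lead_coef p)^-1 *: p.

Variables (p : {poly K}) (hp : basic_irreducible p).

Fact monic_assoc_irr : monic_irreducible_poly (monic_assoc p).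
Proof.
have [[sp irr] dp _] := hp.
have l0 : (lead_coef p)^-1 != 0.
  by rewrite invr_eq0 lead_coef_eq0 -size_poly_gt0 ltnW.
split; last by rewrite monicE lead_coefZ mulVf // -invr_eq0.
split=> [|q q1]; first by rewrite size_scale.
rewrite dvdpZr // => /(irr q q1) h; rewrite (eqp_trans h) // eqp_sym.
exact: eqp_scale.
Qed.

Definition quot_field : fieldType := {poly %/ monic_assoc p with monic_assoc_irr}.

Definition quot_field_in : {rmorphism K -> quot_field} := in_alg quot_field.

Definition xbar : quot_field := in_qpoly (monic_assoc p) 'X.

Fact xbar_neq0 : xbar != 0.
Proof.
have [[sp _] dp _] := hp.
have l0 : (lead_coef p)^-1 != 0.
  by rewrite invr_eq0 lead_coef_eq0 -size_poly_gt0 ltnW.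
have sX : (size ('X : {poly K}) < size (mk_monic (monic_assoc p)))%N.
  rewrite (mk_monicE monic_assoc_irr) size_scale // size_polyX.
  by case: (size p) dp => [|[|[|n]]].
apply/eqP => x0; have /esym := in_qpoly_small sX.
rewrite -[in_qpoly _ _]/(xbar : {poly %/ _}) x0 => /eqP.
by rewrite polyX_eq0.
Qed.

Definition chen_poly (E : graph) (e : gcycle E) : lpamod K E :=
  restrict_mod quot_field_in (twist (chead e) xbar_neq0 (chen quot_field e)).

End TwistedChen.

(* Main.v *)
From HB Require Import structures.
From mathcomp Require Import all_boot all_order all_algebra.
From mathcomp Require Import boolp qpoly qfpoly.
Require Import Defs.

Set Implicit Arguments.
Unset Strict Implicit.
Unset Printing Implicit Defensive.

Import GRing.Theory.
Local Open Scope ring_scope.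

(** Write M = V^p_[c^oo], N = V^q_[e^oo], and let P be the operator p(c) on
    left modules, c acting as the product of its edges.  In M the vector
    w = c^oo satisfies c w = xbar w, hence P w = 0.  For an extension X of M
    by N and a lift x of w to X, the vector P x lies in N, and its class in
    N / P N does not depend on x: this is the connecting homomorphism
    Ext^1(M, N) -> N / P N (see [connects]; it is linear for the Baer sum, and
    the split extension goes to 0).  So it suffices to find arbitrarily many
    extensions whose classes in N / P N are independent.

    Every n with s(c) n = n is, up to the nonzero scalar lead_coef p, the class
    of some extension.  On N + M let the edges and ghost edges act diagonally,
    and perturb the action of one edge g by a linear map
    alpha : r(g) M -> s(g) N; the relations hold as soon as each f^* is
    corrected by - f^* alpha g^* ([edge_ext]).  Let g be the first edge of c, and
    t the infinite path that remains of c^oo without it; let alpha send k t, for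
    k in K[x]/p, to n times the coefficient of x^(deg p - 1) in k, and all other
    infinite paths to 0.  Then the powers of c below deg p move (0, w) inside M,
    and only the leading term of P reaches N ([head_ext_connects]).

    The quotient N / P N is infinite-dimensional because the graph has room.
    If c or e is not exclusive, there is a vertex u with paths from s(c) to u and
    from u to s(e), at which two cycles are based, neither a prefix of the
    other.  Going from s(c) to u along a path that leaves c within its first
    turn, then i times around the first cycle, once around the second and on to
    e^oo gives infinite paths r_0, r_1, ... that do not start with c, and whose
    translates c^m r_i are all distinct ([independent_tails]).  The coefficients of y on the orbit of r_i form a
    polynomial, and P acts on this polynomial as multiplication by a polynomial
    of degree deg p > 0, so that no nonzero constant is in its image
    ([delta_indep]). *)

(** * Generators and relations of the Leavitt path algebra *)

(** One name for f and f^*, so that the relations that treat edges and ghost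
    edges alike are stated once. *)
Definition gen (K : fieldType) (E : graph) (g : edge (double E)) : lpa K E :=
  lpa_pi (delta K (@epath (double E) g)).
Arguments gen {K E} g.

Section Generators.
Variables (K : fieldType) (E : graph).
Implicit Types (u v : vert E) (g : edge (double E)).
Local Notation gen := (@gen K E).

Lemma pi_pathM (p q r : gpath (double E)) : pcomp p q = Some r ->
  lpa_mul (lpa_pi (delta K p)) (lpa_pi (delta K q)) = lpa_pi (delta K r).
Proof. by move=> h; rewrite lpa_mulE pamulUU /pmul1 h. Qed.

Lemma pi_pathM0 (p q : gpath (double E)) : ptgt p != psrc q ->
  lpa_mul (lpa_pi (delta K p)) (lpa_pi (delta K q)) = 0.
Proof. by move=> h; rewrite lpa_mulE pamulUU /pmul1 pcompN // linear0. Qed.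

Lemma pcomp_eq (p q r : gpath (double E)) : ptgt p = psrc q -> psrc p = psrc r ->
  pedges p ++ pedges q = pedges r -> pcomp p q = Some r.
Proof.
move=> h e1 e2; rewrite (pcompE h); congr Some; apply: val_inj => /=.
by rewrite e1 e2; case: r {e1 e2} => -[].
Qed.

Lemma lpa_vertM u v :
  lpa_mul (lpa_vert K u) (lpa_vert K v) = if u == v then lpa_vert K u else 0.
Proof.
case: eqVneq => [<-|n]; first exact/pi_pathM/pcomp_eq.
exact: pi_pathM0.
Qed.

Lemma lpa_vert_gen v g :
  lpa_mul (lpa_vert K v) (gen g) = if v == src g then gen g else 0.
Proof.
case: eqVneq => [->|n]; first exact/pi_pathM/pcomp_eq.
exact: pi_pathM0.
Qed.

Lemma lpa_gen_vert v g :
  lpa_mul (gen g) (lpa_vert K v) = if tgt g == v then gen g else 0.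
Proof.
case: eqVneq => [<-|n]; first exact/pi_pathM/pcomp_eq.
exact: pi_pathM0.
Qed.

Lemma lpa_ck1 (f h : edge E) : lpa_mul (lpa_ghost K f) (lpa_edge K h) =
  if f == h then lpa_vert K (tgt f) else 0.
Proof.
rewrite lpa_mulE; apply/eqP; rewrite -subr_eq0.
have -> : (if f == h then lpa_vert K (tgt f) else 0) =
    @lpa_pi K E (if f == h then pa_vert K (tgt f) else 0).
  by case: eqP => // _; rewrite linear0.
by rewrite -linearB; apply/eqP/(qpi_eq0 (leavitt_ideal K E))/lid_rel/CK1.
Qed.

Lemma lpa_ck2 v (fs : seq (edge E)) :
  fs != [::] -> uniq fs -> (forall f, (f \in fs) = (src f == v)) ->
  lpa_vert K v = \sum_(f <- fs) lpa_mul (lpa_edge K f) (lpa_ghost K f).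
Proof.
move=> h1 h2 h3; apply/eqP; rewrite -subr_eq0; apply/eqP.
under eq_bigr do rewrite lpa_mulE.
rewrite -linear_sum -linearB /=.
by apply/(qpi_eq0 (leavitt_ideal K E))/lid_rel/CK2.
Qed.

(** Paths of positive length factor as an edge of the double graph times a
    shorter path, so that multiplicative statements about L_K(E) need to be
    checked on the generators only. *)
Lemma lpa_path_ind (P : lpa K E -> Prop) :
  P 0 -> (forall x y, P x -> P y -> P (x + y)) ->
  (forall c x, P x -> P (c *: x)) -> (forall v, P (lpa_vert K v)) ->
  (forall g x, P x -> P (lpa_mul (gen g) x)) -> forall x, P x.
Proof.
move=> P0 PD PZ Pv Pg x; rewrite -(lpa_reprK x); move: (lpa_repr x) => {x}.
elim/freemod_ind => [|a b ha hb|a b hb|p].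
- by rewrite linear0.
- by rewrite linearD; apply: PD.
- by rewrite linearZ; apply: PZ.
case: p => -[v s]; elim: s v => [|g s IH] v c.
  have -> : GPath c = @vpath (double E) v by apply: val_inj.
  exact: Pv.
have cs : chain (tgt g, s).1 (tgt g, s).2 by case/andP: (c).
rewrite -(@pi_pathM (epath g) (GPath cs)); first exact: Pg.
by apply: pcomp_eq => //; case/andP: (c) => /eqP.
Qed.

End Generators.

Section ActLinear.
Variables (K : fieldType) (E : graph) (M : lpamod K E).
Implicit Types (x y : lpa K E) (m : M) (u v : vert E) (g : edge (double E)).

Lemma act0l m : act 0 m = 0. Proof. exact: (linear0 (actr m)). Qed.
Lemma actDl x y m : act (x + y) m = act x m + act y m.
Proof. exact: (linearD (actr m)). Qed.
Lemma actZl c x m : act (c *: x) m = c *: act x m.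
Proof. exact: (linearZ_LR (actr m)). Qed.
Lemma act_suml I (r : seq I) (F : I -> lpa K E) m :
  act (\sum_(i <- r) F i) m = \sum_(i <- r) act (F i) m.
Proof. exact: (linear_sum (actr m)). Qed.
Lemma act0r x : act x (0 : M) = 0. Proof. exact: (linear0 (act x)). Qed.
Lemma actDr x m m' : act x (m + m') = act x m + act x m'.
Proof. exact: (linearD (act x)). Qed.
Lemma actNr x m : act x (- m) = - act x m.
Proof. exact: (linearN (act x)). Qed.
Lemma actZr x c m : act x (c *: m) = c *: act x m.
Proof. exact: (linearZ_LR (act x)). Qed.

Lemma act_vertM u v m :
  act (lpa_vert K u) (act (lpa_vert K v) m) =
  if u == v then act (lpa_vert K u) m else 0.
Proof. by rewrite -actM lpa_vertM; case: eqP => // _; rewrite act0l. Qed.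

Lemma act_vert_gen v g m :
  act (lpa_vert K v) (act (gen g) m) = if v == src g then act (gen g) m else 0.
Proof. by rewrite -actM lpa_vert_gen; case: eqP => // _; rewrite act0l. Qed.

Lemma act_gen_vert v g m :
  act (gen g) (act (lpa_vert K v) m) = if tgt g == v then act (gen g) m else 0.
Proof. by rewrite -actM lpa_gen_vert; case: eqP => // _; rewrite act0l. Qed.

Lemma act_ck1 (f h : edge E) m :
  act (lpa_ghost K f) (act (lpa_edge K h) m) =
  if f == h then act (lpa_vert K (tgt f)) m else 0.
Proof. by rewrite -actM lpa_ck1; case: eqP => // _; rewrite act0l. Qed.

Lemma act_ck2 v (fs : seq (edge E)) m :
  fs != [::] -> uniq fs -> (forall f, (f \in fs) = (src f == v)) ->
  act (lpa_vert K v) m =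
  \sum_(f <- fs) act (lpa_edge K f) (act (lpa_ghost K f) m).
Proof.
move=> h1 h2 h3; rewrite (lpa_ck2 K h1 h2 h3) act_suml.
by apply: eq_bigr => f _; rewrite actM.
Qed.

End ActLinear.

Section HomGenerators.
Variables (K : fieldType) (E : graph) (M N : lpamod K E) (f : {linear M -> N}).
Hypothesis f_vert : forall v m, f (act (lpa_vert K v) m) = act (lpa_vert K v) (f m).
Hypothesis f_gen : forall g m, f (act (gen g) m) = act (gen g) (f m).

Lemma hom_of_gen x m : f (act x m) = act x (f m).
Proof.
elim/lpa_path_ind: x m => [|x y hx hy|c x hx|v|g x hx] m.
- by rewrite !act0l linear0.
- by rewrite !actDl linearD hx hy.
- by rewrite !actZl linearZ hx.
- exact: f_vert.
- by rewrite !actM f_gen hx.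
Qed.

End HomGenerators.

(** * Modules from representations of the double graph *)

(** A family of operators indexed by the vertices, edges and ghost edges that
    satisfies the defining relations of L_K(E) extends to a unital module: this
    is the presentation of L_K(E) read as a universal property. *)
Section Representation.
Variables (K : fieldType) (E : graph) (V : lmodType K).
Variables (rv : vert E -> {linear V -> V}) (re : edge (double E) -> {linear V -> V}).
Hypothesis rvM : forall u v x, rv u (rv v x) = if u == v then rv u x else 0.
Hypothesis rv_src : forall (g : edge (double E)) x, rv (src g) (re g x) = re g x.
Hypothesis re_tgt : forall (g : edge (double E)) x, re g (rv (tgt g) x) = re g x.
Hypothesis re_ck1 : forall (f h : edge E) x,
  re (inr f) (re (inl h) x) = if f == h then rv (tgt f) x else 0.
Hypothesis re_ck2 : forall v (fs : seq (edge E)) x,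
  fs != [::] -> uniq fs -> (forall f, (f \in fs) = (src f == v)) ->
  rv v x = \sum_(f <- fs) re (inl f) (re (inr f) x).
Hypothesis rv_unital : forall x, exists vs, x = \sum_(v <- vs) rv v x.

Implicit Types (p q : gpath (double E)) (g : edge (double E)).

Definition rep_path (p : gpath (double E)) (x : V) : V :=
  foldr (fun g y => re g y) (rv (ptgt p) x) (pedges p).

Lemma rep_path_linear p : linear (rep_path p).
Proof.
rewrite /rep_path => c x y; elim: (pedges p) => [|g s IH] /=; first exact: linearP.
by rewrite IH linearP.
Qed.

Lemma rep_path_src p x : rv (psrc p) (rep_path p x) = rep_path p x.
Proof.
case: p => -[v [|g s]] c; rewrite /rep_path /ptgt /psrc /=.
  by rewrite rvM eqxx.
have /andP[/eqP/= <- _] := c; exact: rv_src.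
Qed.

(** Non-composable paths have product 0, and the operators agree because
    distinct vertices act as orthogonal idempotents. *)
Lemma rep_path_comp p q x :
  rep_path p (rep_path q x) = if pcomp p q is Some r then rep_path r x else 0.
Proof.
have [h|n] := eqVneq (ptgt p) (psrc q).
  rewrite (pcompE h) [rep_path p _]/rep_path h rep_path_src /rep_path ptgt_cat.
  by rewrite {3}/pedges /= foldr_cat.
rewrite (pcompN n) [rep_path p _]/rep_path -rep_path_src rvM (negbTE n).
by elim: (pedges p) => //= g s ->; rewrite linear0.
Qed.

Definition rep_pact (a : freemod K (gpath (double E))) (x : V) : V :=
  lin (rep_path^~ x) a.

Lemma rep_pact_linl x : linear (rep_pact^~ x).
Proof. exact: linearP. Qed.
Definition rep_pactr x a := rep_pact a x.
HB.instance Definition _ x := GRing.isLinear.Build K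
  (freemod K (gpath (double E))) V *:%R (rep_pactr x) (rep_pact_linl x).

Lemma rep_pact_linr a : linear (rep_pact a).
Proof.
move=> c x y; rewrite /rep_pact !linE scaler_sumr -big_split /=.
apply: eq_bigr => p _; rewrite rep_path_linear scalerDr.
by rewrite !scalerA mulrC.
Qed.
HB.instance Definition _ a := GRing.isLinear.Build K V V *:%R
  (rep_pact a) (rep_pact_linr a).

Lemma rep_pactU p x : rep_pact (delta K p) x = rep_path p x.
Proof. exact: linU. Qed.
Lemma rep_pact0 x : rep_pact 0 x = 0.
Proof. exact: (linear0 (rep_pactr x)). Qed.
Lemma rep_pactD a b x : rep_pact (a + b) x = rep_pact a x + rep_pact b x.
Proof. exact: (linearD (rep_pactr x)). Qed.
Lemma rep_pactB a b x : rep_pact (a - b) x = rep_pact a x - rep_pact b x.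
Proof. exact: (linearB (rep_pactr x)). Qed.
Lemma rep_pactZ c a x : rep_pact (c *: a) x = c *: rep_pact a x.
Proof. exact: (linearZ_LR (rep_pactr x)). Qed.
Lemma rep_pact_sum I (r : seq I) F x :
  rep_pact (\sum_(i <- r) F i) x = \sum_(i <- r) rep_pact (F i) x.
Proof. exact: (linear_sum (rep_pactr x)). Qed.

Lemma rep_pactM a b x : rep_pact (pamul a b) x = rep_pact a (rep_pact b x).
Proof.
elim/freemod_ind: a => [|a a' h h'|c a h|p].
- by rewrite pamul0l !rep_pact0.
- by rewrite pamulDl !rep_pactD h h'.
- by rewrite pamulZl !rep_pactZ h.
elim/freemod_ind: b => [|b b' h h'|c b h|q].
- by rewrite pamul0r !rep_pact0 linear0.
- by rewrite pamulDr !rep_pactD linearD h h'.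
- by rewrite pamulZr !rep_pactZ linearZ h.
rewrite pamulUU !rep_pactU rep_path_comp /pmul1.
by case: (pcomp p q) => [r|]; rewrite ?rep_pactU ?rep_pact0.
Qed.

Lemma rep_pact_vert v x : rep_pact (pa_vert K v) x = rv v x.
Proof. by rewrite rep_pactU. Qed.

Lemma rep_pact_gen g x : rep_pact (delta K (@epath (double E) g)) x = re g x.
Proof. by rewrite rep_pactU /rep_path /= re_tgt. Qed.

Lemma rep_pact_ideal a : in_leavitt_ideal a -> forall x, rep_pact a x = 0.
Proof.
elim=> {a} [_ []||a b _ ha _ hb|c a _ ha|a b _ hb|a b _ ha]
  => [f h|v fs n0 ufs fsP|||||] x.
- rewrite rep_pactB rep_pactM !rep_pact_gen re_ck1.
  by case: (f == h); rewrite ?rep_pact_vert ?rep_pact0 subrr.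
- rewrite rep_pactB rep_pact_vert rep_pact_sum (re_ck2 x n0 ufs fsP).
  apply/eqP; rewrite subr_eq0; apply/eqP/eq_bigr => f _.
  by rewrite rep_pactM !rep_pact_gen.
- exact: rep_pact0.
- by rewrite rep_pactD ha hb addr0.
- by rewrite rep_pactZ ha scaler0.
- by rewrite rep_pactM hb linear0.
- by rewrite rep_pactM ha.
Qed.

Definition rep_act (a : lpa K E) (x : V) : V := rep_pact (lpa_repr a) x.

Lemma rep_actE a x : rep_act (lpa_pi a) x = rep_pact a x.
Proof.
by apply: (qreprE (f := rep_pactr x)) => b /rep_pact_ideal; apply.
Qed.

Fact rep_act_linl x : linear (rep_act^~ x).
Proof.
by apply: (qrepr_linear (f := rep_pactr x)) => b /rep_pact_ideal; apply.
Qed.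
Fact rep_act_linr a : linear (rep_act a).
Proof. exact: rep_pact_linr. Qed.
Fact rep_actM a b x : rep_act (lpa_mul a b) x = rep_act a (rep_act b x).
Proof. by rewrite rep_actE rep_pactM. Qed.
Fact rep_act_unital x : exists s : seq (lpa K E * V),
  x = \sum_(z <- s) rep_act z.1 z.2.
Proof.
have [vs xE] := rv_unital x; exists [seq (lpa_vert K v, x) | v <- vs].
rewrite big_map {1}xE; apply: eq_bigr => v _.
by rewrite rep_actE rep_pact_vert.
Qed.

Definition rep_mod : lpamod K E :=
  Lpamod rep_act_linl rep_act_linr rep_actM rep_act_unital.

Lemma rep_mod_vert v (x : rep_mod) : act (lpa_vert K v) x = rv v x.
Proof. by rewrite /= rep_actE rep_pact_vert. Qed.
Lemma rep_mod_gen g (x : rep_mod) : act (gen g) x = re g x.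
Proof. by rewrite /= rep_actE rep_pact_gen. Qed.

End Representation.

(** * The extension that a map attaches to an edge *)

(** Extensions of M by N, given on N * M by one linear map al from r(g0) M to
    s(g0) N.  The edge g0 acts on M with the additional term al.  By CK1, f^*
    must then change by - f^* al on g0 M, whence the term - f^* al (g0^* m).  In
    CK2 the sum over f of - f f^* al (g0^* m) is - al (g0^* m), which cancels
    the term that g0 adds to g0 g0^* m. *)
Section EdgeExtension.
Variables (K : fieldType) (E : graph) (M N : lpamod K E) (g0 : edge E).
Variable al : {linear M -> N}.
Hypothesis al_src : forall m, act (lpa_vert K (src g0)) (al m) = al m.
Hypothesis al_tgt : forall m, al (act (lpa_vert K (tgt g0)) m) = al m.
Implicit Types (g : edge (double E)) (m : M) (z : prod_mod N M).

Definition ee_der g m : N :=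
  match g with
  | inl f => if f == g0 then al m else 0
  | inr f => - act (lpa_ghost K f) (al (act (lpa_ghost K g0) m))
  end.

Lemma ee_der_linear g : linear (ee_der g).
Proof.
case: g => f c m m' /=; last first.
  by rewrite act_linr linearP act_linr opprD scalerN.
by case: eqP; rewrite ?linearP // scaler0 addr0.
Qed.
HB.instance Definition _ g :=
  GRing.isLinear.Build K M N *:%R (ee_der g) (ee_der_linear g).

Definition ee_gen g z : prod_mod N M :=
  (act (gen g) z.1 + ee_der g z.2, act (gen g) z.2).

Lemma ee_gen_linear g : linear (ee_gen g).
Proof.
move=> c z z'; congr (_, _) => /=; last exact: linearP.
by rewrite !linearP scalerDr addrACA.
Qed.
HB.instance Definition _ g := GRing.isLinear.Build K
  (prod_mod N M) (prod_mod N M) *:%R (ee_gen g) (ee_gen_linear g).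

Definition ee_vert (v : vert E) : {linear prod_mod N M -> prod_mod N M} :=
  @act K E (prod_mod N M) (lpa_vert K v).

Fact ee_vertM u v z : ee_vert u (ee_vert v z) = if u == v then ee_vert u z else 0.
Proof. exact: act_vertM. Qed.

Lemma ee_der_src g m : act (lpa_vert K (src g : vert E)) (ee_der g m) = ee_der g m.
Proof.
case: g => f /=.
  by case: eqP => [->|_]; rewrite ?act0r.
by rewrite actNr (act_vert_gen _ (inr f)) eqxx.
Qed.

Lemma ee_der_tgt g m : ee_der g (act (lpa_vert K (tgt g : vert E)) m) = ee_der g m.
Proof.
case: g => f /=.
  by case: eqP => [->|_].
rewrite (act_gen_vert _ (inr g0)) /= eq_sym; have [//|n] := eqVneq.
rewrite linear0 act0r -[al _]al_src (act_gen_vert _ (inr f)) /=.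
by rewrite (negbTE n).
Qed.

Fact ee_vert_src g z : ee_vert (src g) (ee_gen g z) = ee_gen g z.
Proof.
congr (_, _) => /=; last by rewrite act_vert_gen eqxx.
by rewrite actDr act_vert_gen eqxx ee_der_src.
Qed.

Fact ee_vert_tgt g z : ee_gen g (ee_vert (tgt g) z) = ee_gen g z.
Proof. by congr (_, _); rewrite /= ?ee_der_tgt act_gen_vert eqxx. Qed.

Fact ee_ck1 (f h : edge E) z : ee_gen (inr f) (ee_gen (inl h) z) =
  if f == h then ee_vert (tgt f) z else 0.
Proof.
have -> : ee_gen (inr f) (ee_gen (inl h) z) =
    act (lpa_ghost K f) (act (lpa_edge K h) z).
  congr (_, _) => /=; rewrite actDr -addrA -[RHS]addr0; congr (_ + _).
  rewrite [act (lpa_ghost K g0) _]act_ck1.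
  have [_|_] := eqVneq h g0; first by rewrite al_tgt subrr.
  by rewrite !linear0 addr0.
exact: act_ck1.
Qed.

Fact ee_ck2 v (fs : seq (edge E)) z :
  fs != [::] -> uniq fs -> (forall f, (f \in fs) = (src f == v)) ->
  ee_vert v z = \sum_(f <- fs) ee_gen (inl f) (ee_gen (inr f) z).
Proof.
move=> h1 h2 h3; rewrite [LHS](act_ck2 _ h1 h2 h3).
pose y := al (act (lpa_ghost K g0) z.2).
have y_src : act (lpa_vert K v) y = if v == src g0 then y else 0.
  by rewrite /y -al_src act_vertM; case: eqP => [->|].
have der0 : \sum_(f <- fs) (if f == g0 then y else 0) -
    \sum_(f <- fs) act (lpa_edge K f) (act (lpa_ghost K f) y) = 0.
  rewrite -(act_ck2 _ h1 h2 h3) y_src; have [vg|vg] := eqVneq v (src g0).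
    rewrite (bigD1_seq g0) ?h3 ?vg //= eqxx big1 ?addr0 ?subrr // => f.
    by move/negbTE => ->.
  rewrite big_seq big1 ?subrr // => f; rewrite h3 => /eqP fv.
  by have [fg|//] := eqVneq f g0; rewrite -fv fg eqxx in vg.
rewrite [RHS](_ : _ = \sum_(f <- fs) act (lpa_edge K f) (act (lpa_ghost K f) z) +
   \sum_(f <- fs) (((if f == g0 then y else 0) -
   act (lpa_edge K f) (act (lpa_ghost K f) y), 0) : prod_mod N M)).
  rewrite -[LHS]addr0; congr (_ + _).
  rewrite -(big_morph (@split_inj _ _ M N) (id1 := 0) (op1 := +%R)
    (id2 := 0) (op2 := +%R)) ?sumrB ?der0 //.
  by move=> n n'; congr (_, _); rewrite /= addr0.
rewrite -big_split /=; apply: eq_bigr => f _.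
congr (_, _) => /=; last by rewrite addr0.
rewrite actDr actNr -addrA [X in _ = _ + X]addrC; congr (_ + (_ + _)).
by have [->|] := eqVneq f g0.
Qed.

Fact ee_unital z : exists vs, z = \sum_(v <- vs) ee_vert v z.
Proof.
have [vs zE] := act_local_unit z; exists vs.
by rewrite -[LHS]zE act_suml.
Qed.

Definition edge_mod : lpamod K E :=
  rep_mod ee_vertM ee_vert_src ee_vert_tgt ee_ck1 ee_ck2 ee_unital.

Lemma edge_mod_gen g (z : edge_mod) : act (gen g) z = ee_gen g z.
Proof. exact: rep_mod_gen. Qed.
Lemma edge_mod_vert v (z : edge_mod) : act (lpa_vert K v) z = ee_vert v z.
Proof. exact: rep_mod_vert. Qed.

Definition ee_inj (n : N) : edge_mod := (n, 0).
Fact ee_inj_lin : linear ee_inj.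
Proof. by move=> c n n'; congr (_, _); rewrite /= scaler0 addr0. Qed.
HB.instance Definition _ := GRing.isLinear.Build K N edge_mod *:%R ee_inj ee_inj_lin.
Fact ee_inj_act x n : ee_inj (act x n) = act x (ee_inj n).
Proof.
apply: (hom_of_gen (f := ee_inj)) => [v|g] {}n.
  by rewrite edge_mod_vert; congr (_, _); rewrite /= act0r.
by rewrite edge_mod_gen; congr (_, _); rewrite /= ?act0r // linear0 addr0.
Qed.

Definition ee_sur (z : edge_mod) : M := z.2.
Fact ee_sur_lin : linear ee_sur. Proof. by []. Qed.
HB.instance Definition _ := GRing.isLinear.Build K edge_mod M *:%R ee_sur ee_sur_lin.
Fact ee_sur_act x (z : edge_mod) : ee_sur (act x z) = act x (ee_sur z).
Proof.
apply: (hom_of_gen (f := ee_sur)) => [v|g] {}z; first by rewrite edge_mod_vert.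
by rewrite edge_mod_gen.
Qed.
Fact ee_injP : injective ee_inj. Proof. by move=> n n' []. Qed.
Fact ee_surP m : exists z, ee_sur z = m.
Proof. by exists (0, m). Qed.
Fact ee_exact z : ee_sur z = 0 <-> exists n, ee_inj n = z.
Proof. by case: z => n m; split=> [/= ->|[n' [_ <-]]] //; exists n. Qed.

Definition edge_ext : extension M N :=
  @Extension K E M N edge_mod (Lpahom ee_inj_lin ee_inj_act)
    (Lpahom ee_sur_lin ee_sur_act) ee_injP ee_surP ee_exact.

End EdgeExtension.

(** * The connecting homomorphism on extensions *)

Section StructureMaps.
Variables (K : fieldType) (E : graph).

Definition fst_hom (M N : lpamod K E) : lpahom (prod_mod M N) M :=
  @Lpahom K E (prod_mod M N) M fst (fun _ _ _ => erefl) (fun _ _ => erefl).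
Definition snd_hom (M N : lpamod K E) : lpahom (prod_mod M N) N :=
  @Lpahom K E (prod_mod M N) N snd (fun _ _ _ => erefl) (fun _ _ => erefl).
Definition incl_hom (M : lpamod K E) (S : submodule M) : lpahom (sub_mod S) M :=
  @Lpahom K E (sub_mod S) M (@subval _ _ S) (fun _ _ _ => erefl) (fun _ _ => erefl).

Fact proj_act (M : lpamod K E) (S : submodule M) x (m : M) :
  qpi S (act x m) = act x (qpi S m : quo_mod S).
Proof. by rewrite /= quo_actE. Qed.
Definition proj_hom (M : lpamod K E) (S : submodule M) : lpahom M (quo_mod S) :=
  @Lpahom K E M (quo_mod S) (qpi S) (qpi_linear S) (@proj_act M S).

End StructureMaps.

Section PolyAct.
Variables (K : fieldType) (E : graph) (p : {poly K}) (s : seq (edge E)).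

Definition edges_act (M : lpamod K E) (m : M) : M :=
  foldr (fun f y => act (lpa_edge K f) y) m s.

(** The power 0 of s acts as the identity, not as the vertex at which s is
    based: this gives an operator on every module that commutes with all
    homomorphisms. *)
Definition poly_act (M : lpamod K E) (m : M) : M :=
  \sum_(j < size p) p`_j *: iter j (@edges_act M) m.

Lemma hom_edges_act (M N : lpamod K E) (f : lpahom M N) m :
  f (edges_act m) = edges_act (f m).
Proof.
by rewrite /edges_act; elim: s => //= g t IH; rewrite hom_act IH.
Qed.

Lemma hom_poly_act (M N : lpamod K E) (f : lpahom M N) m :
  f (poly_act m) = poly_act (f m).
Proof.
rewrite [LHS](linear_sum f); apply: eq_bigr => j _.
rewrite [LHS](linearZ_LR f); congr (_ *: _).
by elim: (j : nat) => //= k IH; rewrite hom_edges_act IH.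
Qed.

Lemma poly_act_pair (M N : lpamod K E) (z : prod_mod M N) :
  poly_act z = (poly_act z.1, poly_act z.2).
Proof.
rewrite [LHS]surjective_pairing; congr (_, _).
  exact: (hom_poly_act (fst_hom M N)).
exact: (hom_poly_act (snd_hom M N)).
Qed.

Lemma edges_act0 (M : lpamod K E) : edges_act (0 : M) = 0.
Proof. by rewrite /edges_act; elim: s => //= g t ->; rewrite act0r. Qed.

Lemma poly_act0 (M : lpamod K E) : poly_act (0 : M) = 0.
Proof.
rewrite /poly_act big1 // => j _; suff -> : iter j (@edges_act M) 0 = 0.
  by rewrite scaler0.
by elim: (j : nat) => //= k ->; rewrite edges_act0.
Qed.

Section Connecting.
Implicit Types (M N : lpamod K E).

(** The class of n in N / P N, P = [poly_act p s], is the image of X under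
    the connecting homomorphism at a vector w with P w = 0.  It is kept as a
    relation between X and n, since n is determined up to P N only. *)
Definition connects M N (w : M) (X : extension M N) (n : N) : Prop :=
  exists2 x, ext_sur X x = w & poly_act x = ext_inj X n.

Lemma connects_equiv M N (w : M) (X Y : extension M N) n :
  ext_equiv X Y -> connects w X n -> connects w Y n.
Proof.
move=> [f [f_inj f_sur]] [x xw xn]; exists (f x); first by rewrite f_sur.
by rewrite -hom_poly_act xn f_inj.
Qed.

Lemma connects_split M N (w : M) n :
  connects w (ext_split M N) n -> exists y, n = poly_act y.
Proof.
move=> [[y m] _ /(congr1 fst) /=]; rewrite poly_act_pair /= => <-.
by exists y.
Qed.

Lemma split_connects M N (w : M) : poly_act w = 0 -> connects w (ext_split M N) 0.
Proof.
by move=> w0; exists (0, w) => //; rewrite poly_act_pair /= w0 poly_act0.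
Qed.

Lemma connects_prod M M' N N' (w : M) (w' : M') (X : extension M N)
    (Y : extension M' N') n n' :
  connects w X n -> connects w' Y n' ->
  connects ((w, w') : prod_mod M M') (ext_prod X Y) (n, n').
Proof.
move=> [x xw xn] [y yw yn]; exists (x, y); first by rewrite /= /pe_sur /= xw yw.
by rewrite poly_act_pair /= xn yn.
Qed.

Lemma connects_pull M M' N (g : lpahom M' M) (X : extension M N) w n :
  poly_act w = 0 -> connects (g w) X n -> connects w (ext_pull g X) n.
Proof.
move=> w0 [x xw xn]; have h : pb_sub g X (x, w) by [].
exists (insub_of h : sub_mod (pb_sub g X)); first by [].
apply: val_inj; rewrite /= [LHS](hom_poly_act (incl_hom (pb_sub g X))).
by rewrite poly_act_pair /= xn w0.
Qed.

Lemma connects_push M N N' (h : lpahom N N') (X : extension M N) w n :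
  connects w X n -> connects w (ext_push h X) (h n).
Proof.
move=> [x xw xn]; pose z : prod_mod (ext_mid X) N' := (x, 0).
exists (qpi (po_sub h X) z : quo_mod (po_sub h X)).
  by rewrite /= po_surE /po_fst.
rewrite -(hom_poly_act (proj_hom (po_sub h X))) poly_act_pair /= xn poly_act0.
by apply/qpiP; exists n; congr (_, _); rewrite /= ?subr0 ?sub0r.
Qed.

Lemma connects_baer M N (w : M) (X Y : extension M N) n n' : poly_act w = 0 ->
  connects w X n -> connects w Y n' -> connects w (baer_sum X Y) (n + n').
Proof.
move=> w0 hX hY; apply: (connects_push (codiag_hom N) (n := (n, n'))).
exact/connects_pull/connects_prod.
Qed.

Lemma connects_lincomb M N (w : M) k (a : 'I_k -> K) (xi : 'I_k -> extension M N) n :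
  poly_act w = 0 -> (forall i, connects w (xi i) (n i)) ->
  connects w (ext_lincomb a xi) (\sum_i a i *: n i).
Proof.
move=> w0 hxi; apply: (big_ind2 (connects w)) => [|X1 n1 X2 n2|i _].
- exact: split_connects.
- exact: connects_baer.
- exact: (connects_push (homothety_hom N (a i))).
Qed.

(** The connecting homomorphism is linear and vanishes on split extensions, so
    independence can be tested on its values in N / P N. *)
Lemma ext_lin_indepI M N (w : M) k (xi : 'I_k -> extension M N) n :
  poly_act w = 0 -> (forall i, connects w (xi i) (n i)) ->
  (forall a y, \sum_i a i *: n i = poly_act y -> forall i, a i = 0) ->
  ext_lin_indep xi.
Proof.
move=> w0 hxi indep a /connects_equiv/(_ (connects_lincomb a w0 hxi)).
by move=> /connects_split[y /indep].
Qed.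

End Connecting.
End PolyAct.

(** * The action on twisted Chen modules *)

Section ChenAction.
Variables (K : fieldType) (E : graph) (e : gcycle E).
Variables (p : {poly K}) (hp : basic_irreducible p).
Local Notation F := (quot_field hp).
Local Notation C := (freemod F (tail_class e)).
Local Notation M := (chen_poly hp e).
Implicit Types (q : tail_class e) (f : edge E) (k : F) (s : seq (edge E)).

Definition edge_weight f : F := if f == chead e then xbar hp else 1.
Definition seq_weight s : F := \prod_(f <- s) edge_weight f.

Lemma chen_polyZ (a : K) (m : C) :
  a *: (m : M) = (quot_field_in hp a *: m : C).
Proof. by []. Qed.

Lemma chen_poly_actZ x k (m : C) :
  act x ((k *: m : C) : M) = (k *: (act x (m : M) : C) : C).
Proof. exact: (linearZ_LR (chen_act (e := e) _)). Qed.

Lemma chen_poly_edge f q : act (lpa_edge K f) (delta F q : M) =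
  if tgt f =P tsrc q is ReflectT h then (edge_weight f *: delta F (tcons h) : C) else 0.
Proof.
rewrite /= /rs_act /= /twist_act /= lpa_map_edge (gauge_edge _ (xbar_neq0 hp)).
have -> : chen_act (edge_weight f *: lpa_edge F f) (delta F q) =
    edge_weight f *: chen_act (lpa_edge F f) (delta F q).
  exact: (actZl (M := chen F e)).
by rewrite [chen_act _ _]chen_edge; case: eqP => // h; rewrite scaler0.
Qed.

Lemma chen_poly_vert v q : act (lpa_vert K v) (delta F q : M) =
  if v == tsrc q then (delta F q : C) else 0.
Proof.
rewrite /= /rs_act /= /twist_act /= lpa_map_vert (gauge_vert _ (xbar_neq0 hp)).
exact: chen_vert.
Qed.

(* Simplification would otherwise expose the twist and the restriction of
   scalars, and the lemmas above would no longer apply. *)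
#[local] Arguments act : simpl never.

Lemma inf_cat0 (t : nat -> edge E) : inf_cat e [::] t = t.
Proof. by apply/funext => j; rewrite /inf_cat subn0. Qed.

Lemma inf_cat_cons f s (t : nat -> edge E) :
  inf_cat e (f :: s) t = inf_cons f (inf_cat e s t).
Proof. by apply/funext => -[|j]. Qed.

(** A path acts on an infinite path that it can be followed by as
    concatenation, up to the weight that the twist puts on the first edge
    of e. *)
Lemma edges_act_delta v s q : chain v s -> last v (map tgt s) = tsrc q ->
  exists q', [/\ tval q' = inf_cat e s (tval q), tsrc q' = v &
    edges_act s (delta F q : M) = (seq_weight s *: delta F q' : C)].
Proof.
elim: s v => [|f s IH] v /= => [_ ->|/andP[/eqP fv cs] ls].
  by exists q; rewrite inf_cat0 /seq_weight big_nil scale1r.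
have [q1 [q1E q1s IHq]] := IH _ cs ls.
exists (tcons (esym q1s)); split => //; first by rewrite inf_cat_cons /= q1E.
rewrite IHq [LHS]chen_poly_actZ chen_poly_edge.
case: eqP => [h|n]; last by case: n; rewrite q1s.
rewrite /seq_weight big_cons scalerA mulrC; congr (_ *: delta F _).
exact: val_inj.
Qed.

Lemma edges_act_delta0 v s q : s != [::] -> chain v s ->
  last v (map tgt s) != tsrc q -> edges_act s (delta F q : M) = 0.
Proof.
elim: s v => //= f [|g s] IH v _ /= => [_ n|/andP[_ cs] n].
  by rewrite chen_poly_edge; case: eqP => // h; rewrite h eqxx in n.
by have /= -> := IH (tgt f) isT cs n; rewrite act0r.
Qed.

Lemma edges_actZ s k (m : C) :
  edges_act s ((k *: m : C) : M) = (k *: (edges_act s (m : M) : C) : C).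
Proof. by elim: s => //= f s IH; rewrite IH chen_poly_actZ. Qed.

Lemma edges_actD s (m m' : C) :
  edges_act s ((m + m' : C) : M) = (edges_act s (m : M) + edges_act s (m' : M) : C).
Proof. by elim: s => //= f s IH; rewrite IH [LHS]actDr. Qed.

End ChenAction.

Section Cycle.
Variables (K : fieldType) (E : graph) (c : gcycle E).

Lemma cycle_chain : chain (cbase c) (cseq c).
Proof.
have /and3P[_ + _] := gcycleP c => /=; rewrite rcons_path eqxx => /andP[+ _] /=.
by elim: (ctail c) (chead c) => //= g s IH f /andP[/eqP-> /IH ->]; rewrite eqxx.
Qed.

Lemma cycle_last : last (cbase c) (map tgt (cseq c)) = cbase c.
Proof.
have /and3P[_ + _] := gcycleP c => /=; rewrite rcons_path => /andP[_ /eqP].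
by rewrite last_map.
Qed.

Lemma chead_ctail : chead c \notin ctail c.
Proof.
have /and3P[_ _ /= /andP[+ _]] := gcycleP c.
by apply: contra => /(map_f src).
Qed.

Lemma inf_cat_cycle : inf_cat c (cseq c) (einf c) = einf c.
Proof.
apply/funext => j; rewrite /inf_cat; case: ltnP => jn.
  by rewrite /einf modn_small.
by rewrite /einf -{2}(subnK jn) modnDr.
Qed.

Fact tinf_tail : `[< tail_eq c (einf c) >].
Proof. by apply/asboolP; exists (vpath (cbase c)); rewrite inf_cat0. Qed.
Definition tinf : tail_class c := TailClass tinf_tail.

Lemma tsrc_tinf : tsrc tinf = cbase c.
Proof. by rewrite /tsrc /= einf0. Qed.

Variables (p : {poly K}) (hp : basic_irreducible p).
Local Notation F := (quot_field hp).
Local Notation C := (freemod F (tail_class c)).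
Local Notation M := (chen_poly hp c).

Lemma seq_weight_ctail : seq_weight c hp (ctail c) = 1.
Proof.
rewrite /seq_weight big_seq big1 // => f ft; rewrite /edge_weight.
by case: eqP ft chead_ctail => // -> ->.
Qed.

Lemma ctail_tinf :
  edges_act (ctail c) (delta F tinf : M) = (delta F (tshift tinf) : C).
Proof.
have /andP[_ cc] := cycle_chain.
have cl := cycle_last; rewrite /= -tsrc_tinf in cl.
have [q [qE _ ->]] := edges_act_delta hp cc cl.
rewrite seq_weight_ctail scale1r; congr (delta F _); apply: val_inj => /=.
by rewrite qE -[in RHS]inf_cat_cycle inf_cat_cons.
Qed.

(** The first edge of c, which carries the weight xbar, occurs only once in
    the cycle. *)
Lemma cycle_tinf :
  edges_act (cseq c) (delta F tinf : M) = (xbar hp *: delta F tinf : C).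
Proof.
have cl := cycle_last; rewrite -tsrc_tinf in cl.
have [q [qE _ ->]] := edges_act_delta hp cycle_chain cl.
rewrite /seq_weight big_cons -/(seq_weight _ _ _) seq_weight_ctail mulr1.
rewrite /edge_weight eqxx; congr (_ *: delta F _); apply: val_inj => /=.
by rewrite qE -[in RHS]inf_cat_cycle.
Qed.

Lemma iter_tinf j : iter j (@edges_act _ _ (cseq c) M) (delta F tinf : M) =
  (xbar hp ^+ j *: delta F tinf : C).
Proof.
elim: j => [|j IH]; first by rewrite expr0 scale1r.
by rewrite iterS IH edges_actZ cycle_tinf scalerA -exprSr.
Qed.

Lemma xbarX j : xbar hp ^+ j = in_qpoly (monic_assoc p) 'X^j :> F.
Proof. by rewrite rmorphXn. Qed.

Lemma poly_xbar : \sum_(j < size p) quot_field_in hp p`_j * xbar hp ^+ j = 0.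
Proof.
have horner_xbar (r : {poly K}) : in_qpoly (monic_assoc p) r =
    \sum_(j < size r) quot_field_in hp r`_j * xbar hp ^+ j :> F.
  rewrite -[X in in_qpoly _ X](coefK r) poly_def linear_sum /=.
  by apply: eq_bigr => j _; rewrite xbarX linearZ /= mulr_algl.
rewrite -horner_xbar.
have [l0 mp] : lead_coef p != 0 /\ monic_assoc p \is monic.
  have [_ m] := monic_assoc_irr hp; split=> //.
  rewrite lead_coef_eq0; apply: contraTneq m => p0.
  by rewrite /monic_assoc p0 scaler0 monicE lead_coef0 eq_sym oner_eq0.
apply/val_inj/eqP; rewrite /= (mk_monicE (monic_assoc_irr hp)).
by rewrite -Pdiv.IdomainMonic.modpE // -/(dvdp _ _) dvdpZl ?invr_eq0 // dvdpp.
Qed.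

Lemma poly_act_tinf : poly_act p (cseq c) (delta F tinf : M) = 0.
Proof.
rewrite /poly_act.
transitivity ((\sum_(j < size p) quot_field_in hp p`_j * xbar hp ^+ j) *:
  (delta F tinf : C)); last by rewrite poly_xbar scale0r.
by rewrite scaler_suml; apply: eq_bigr => j _; rewrite iter_tinf chen_polyZ scalerA.
Qed.

End Cycle.

(** * Extensions with prescribed connecting class *)

Section ConnectingClass.
Variables (K : fieldType) (E : graph) (c : gcycle E).
Variables (p : {poly K}) (hp : basic_irreducible p).
Local Notation F := (quot_field hp).
Local Notation C := (freemod F (tail_class c)).
Local Notation M := (chen_poly hp c).
Variables (N : lpamod K E) (n : N).
Hypothesis n_src : act (lpa_vert K (cbase c)) n = n.

Definition top_coef (k : F) : K := (val k)`_(size p).-2.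

Lemma top_coefX j : (j < (size p).-1)%N ->
  top_coef (xbar hp ^+ j) = (j == (size p).-2)%:R.
Proof.
move=> jp; rewrite xbarX /top_coef.
have -> : val (in_qpoly (monic_assoc p) 'X^j) = 'X^j; last by rewrite coefXn eq_sym.
apply: in_qpoly_small; rewrite (mk_monicE (monic_assoc_irr hp)) size_polyXn.
have [_ dp _] := hp.
have p0 : lead_coef p != 0 by rewrite lead_coef_eq0 -size_poly_gt0; case: (size p) dp.
by rewrite size_scale ?invr_eq0 //; case: (size p) jp.
Qed.

(** The coefficient is read at c^oo without its first edge: this is where a turn
    around c, acting on c^oo, stands just before the first edge of c acts. *)
Definition head_map (m : M) : N :=
  top_coef (coef (m : C) (tshift (tinf c))) *: n.

Lemma head_map_linear : linear head_map.
Proof.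
move=> a m m'; rewrite /head_map; set q1 := tshift _.
have -> : coef (a *: m + m' : C) q1 = a *: coef (m : C) q1 + coef (m' : C) q1.
  by rewrite [LHS]coefD [X in X + _](coefZ (quot_field_in hp a)) mulr_algl.
by rewrite scalerA -scalerDl /top_coef /= poly.coefD poly.coefZ.
Qed.
HB.instance Definition _ :=
  GRing.isLinear.Build K M N *:%R head_map head_map_linear.

Lemma head_map_src m : act (lpa_vert K (src (chead c))) (head_map m) = head_map m.
Proof. by rewrite /head_map actZr n_src. Qed.

Lemma head_map_tgt m : head_map (act (lpa_vert K (tgt (chead c))) m) = head_map m.
Proof.
rewrite /head_map; congr (top_coef _ *: _); move: m.
elim/freemod_ind => [|m m' h h'|k m h|q].
- by rewrite [act _ _]act0r.
- by rewrite [act _ _]actDr [LHS]coefD coefD h h'.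
- by rewrite chen_poly_actZ !coefZ h.
rewrite chen_poly_vert; case: eqP => // hq; rewrite coef0 coef_delta.
case: eqP => // qE; case: hq; rewrite qE /tsrc /= /inf_shift.
by rewrite -einf_chain einf0.
Qed.

Definition head_ext : extension M N := edge_ext head_map_src head_map_tgt.
Local Notation X := (ext_mid head_ext).

Lemma edges_act_head (s : seq (edge E)) (y : N) (m : M) : chead c \notin s ->
  edges_act s ((y, m) : X) = (edges_act s y, edges_act s m) :> N * M.
Proof.
elim: s => //= f s IH; rewrite inE negb_or eq_sym => /andP[fc /IH ->].
rewrite [LHS](@edge_mod_gen _ _ _ _ _ _ head_map_src head_map_tgt (inl f)).
by rewrite /ee_gen /= (negbTE fc) addr0.
Qed.

Lemma cycle_act_head (y : N) (k : F) :
  edges_act (cseq c) ((y, k *: delta F (tinf c) : C) : X) =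
  (edges_act (cseq c) y + top_coef k *: n, (k * xbar hp) *: delta F (tinf c) : C)
  :> N * M.
Proof.
have e1 : edges_act (ctail c) ((k *: delta F (tinf c) : C) : M) =
   (k *: delta F (tshift (tinf c)) : C) by rewrite edges_actZ ctail_tinf.
rewrite -[LHS]/(act (lpa_edge K (chead c)) (edges_act (ctail c) (_ : X))).
rewrite edges_act_head ?chead_ctail //.
rewrite [LHS](@edge_mod_gen _ _ _ _ _ _ head_map_src head_map_tgt (inl (chead c))).
rewrite /ee_gen /= eqxx; congr (_, _).
  rewrite e1 /head_map; congr (_ + top_coef _ *: _).
  by rewrite coefZ coef_delta eqxx mulr1.
transitivity (edges_act (cseq c) ((k *: delta F (tinf c) : C) : M)) => //.
by rewrite edges_actZ cycle_tinf scalerA.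
Qed.

(** The top coefficient of xbar ^+ i is 0 for i < deg p - 1, so that fewer than
    deg p turns around c keep (0, c^oo) inside M. *)
Lemma iter_head j : (j < (size p).-1)%N ->
  iter j (@edges_act _ _ (cseq c) X) ((0, delta F (tinf c)) : N * M) =
  (0, xbar hp ^+ j *: delta F (tinf c) : C) :> N * M.
Proof.
elim: j => [_|j IH jp]; first by rewrite expr0 scale1r.
rewrite iterS IH 1?ltnW // cycle_act_head -exprSr top_coefX ?(ltnW jp) //.
rewrite edges_act0.
have -> : (j == (size p).-2) = false; last by rewrite scale0r addr0.
by apply/negbTE; rewrite neq_ltn; case: (size p) jp => [|[|k]] //=; rewrite ltnS => ->.
Qed.

(** In P (0, w), w = c^oo, the part in M is P w = 0, and the only term with a
    part in N is that of degree deg p: its last turn meets xbar ^+ (deg p - 1),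
    whose top coefficient is 1. *)
Lemma head_ext_connects :
  connects p (cseq c) (delta F (tinf c) : M) head_ext (lead_coef p *: n).
Proof.
have [_ dp _] := hp.
pose x : X := ((0, delta F (tinf c)) : N * M).
exists x => //; have [y yx] : exists y, ext_inj head_ext y = poly_act p (cseq c) x.
  apply/ext_exact; rewrite (hom_poly_act _ _ (ext_sur head_ext)).
  exact: poly_act_tinf.
rewrite -yx; congr (ext_inj _ _).
have -> : y = (poly_act p (cseq c) x : N * M).1 by rewrite -yx.
have dE : size p = (size p).-2.+2 by case: (size p) dp => [|[|k]].
have fst_sum I (r : seq I) (G : I -> X) :
    (\sum_(j <- r) G j : N * M).1 = \sum_(j <- r) (G j : N * M).1.
  by elim: r => [|j r IH]; rewrite ?big_nil // !big_cons -IH.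
rewrite /poly_act dE fst_sum big_ord_recr big1 => [|j _].
  rewrite [LHS]add0r [nat_of_ord ord_max]/= iterS iter_head; last by rewrite dE.
  rewrite cycle_act_head top_coefX ?eqxx; last by rewrite dE.
  by rewrite edges_act0 add0r scale1r /= lead_coefE dE.
rewrite iter_head; first exact: scaler0.
by rewrite [X in (_ < X.-1)%N]dE; apply: (ltn_ord j).
Qed.

End ConnectingClass.

(** * Coefficients along an orbit of a closed path *)

Section InfCat.
Variables (E : graph) (e : gcycle E).
Implicit Types (s t : seq (edge E)) (x y : nat -> edge E).

Lemma inf_cat_cat s t x : inf_cat e (s ++ t) x = inf_cat e s (inf_cat e t x).
Proof. by elim: s => [|f s IH]; rewrite ?inf_cat0 //= !inf_cat_cons IH. Qed.

Lemma inf_cons_inj f g x y : inf_cons f x = inf_cons g y -> f = g /\ x = y.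
Proof.
move=> h; split; first exact: (congr1 (@^~ 0%N) h).
by apply/funext => j; apply: (congr1 (@^~ j.+1) h).
Qed.

Lemma inf_cat_inj s : injective (inf_cat e s).
Proof.
elim: s => [|f s IH] x y; first by rewrite !inf_cat0.
by rewrite !inf_cat_cons => /inf_cons_inj[_ /IH].
Qed.

Lemma inf_cat_prefix s t x y : inf_cat e s x = inf_cat e t y ->
  prefix s t || prefix t s.
Proof.
elim: s t => [|f s IH] [|g t] //; rewrite !inf_cat_cons.
by move=> /inf_cons_inj[-> /IH] /=; rewrite eqxx.
Qed.

End InfCat.

Section Orbit.
Variables (K : fieldType) (E : graph) (e : gcycle E).
Variables (q : {poly K}) (hq : basic_irreducible q).
Local Notation F := (quot_field hq).
Local Notation C := (freemod F (tail_class e)).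
Local Notation N := (chen_poly hq e).
Variables (v : vert E) (s : seq (edge E)).
Hypothesis s0 : s != [::].
Hypothesis s_chain : chain v s.
Hypothesis s_last : last v (map tgt s) = v.

Variable r : tail_class e.
Hypothesis r_src : tsrc r = v.
Hypothesis r_root : forall x, tval r <> inf_cat e s x.

Definition on_orbit (m : nat) (t : tail_class e) : Prop :=
  tval t = iter m (inf_cat e s) (tval r).

Lemma orbit_inj m m' t : on_orbit m t -> on_orbit m' t -> m = m'.
Proof.
rewrite /on_orbit => ->; elim: m m' => [|m IH] [|m'] //=.
- by move/r_root.
- by move/esym/r_root.
- by move/inf_cat_inj/IH ->.
Qed.

Lemma orbit_src m t : on_orbit m t -> tsrc t = v.
Proof.
rewrite /tsrc => ->; case: m => [|m]; first exact: r_src.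
by move: s0 s_chain; case: s => //= f t' _ /andP[/eqP <-].
Qed.

(** The polynomial ring is the part of the module that is spanned by the
    infinite paths s^m r: they correspond to the powers of the variable, and all
    other infinite paths are sent to 0. *)
Definition orbit_monomial (t : tail_class e) : {poly F} :=
  if pselect (exists m, on_orbit m t) is left h then 'X^(sval (cid h)) else 0.

Lemma orbit_monomialE m t : on_orbit m t -> orbit_monomial t = 'X^m.
Proof.
move=> h; rewrite /orbit_monomial; case: pselect => [h'|[]]; last by exists m.
by rewrite (orbit_inj (svalP (cid h')) h).
Qed.

Lemma orbit_monomial0 t : (forall m, ~ on_orbit m t) -> orbit_monomial t = 0.
Proof.
by move=> h; rewrite /orbit_monomial; case: pselect => // -[m hm]; case: (h m).
Qed.

Lemma orbit_monomial_cat t t' : tval t' = inf_cat e s (tval t) ->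
  orbit_monomial t' = 'X * orbit_monomial t.
Proof.
move=> tt'; have [[m h]|n] := pselect (exists m, on_orbit m t).
  rewrite (orbit_monomialE h) -exprS; apply: orbit_monomialE.
  by rewrite /on_orbit tt' h.
rewrite (orbit_monomial0 (t := t)) => [|m h]; last by apply: n; exists m.
rewrite mulr0 orbit_monomial0 // => -[|m] h.
  by apply: (r_root (x := tval t)); rewrite -tt' h.
by apply: n; exists m; apply: (@inf_cat_inj _ e s); rewrite -tt' h.
Qed.

Definition orbit_poly (y : C) : {poly F} := lin orbit_monomial y.
Lemma orbit_poly_linear : linear orbit_poly.
Proof. exact: lin_linear. Qed.
HB.instance Definition _ :=
  GRing.isLinear.Build F C {poly F} *:%R orbit_poly orbit_poly_linear.

Lemma orbit_poly0 : orbit_poly 0 = 0. Proof. exact: linear0. Qed.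
Lemma orbit_polyD (x y : C) : orbit_poly (x + y) = orbit_poly x + orbit_poly y.
Proof. exact: linearD. Qed.
Lemma orbit_polyZ k (x : C) : orbit_poly (k *: x) = k *: orbit_poly x.
Proof. exact: linearZ_LR. Qed.
Lemma orbit_polyU t : orbit_poly (delta F t) = orbit_monomial t.
Proof. exact: linU. Qed.

Local Notation kappa := (seq_weight e hq s).

(** Prepending s moves the orbit of r one step forward, and no infinite path
    outside of the orbit enters it, since r does not start with s. *)
Lemma orbit_poly_edges (y : C) :
  orbit_poly (edges_act s (y : N)) = (kappa *: 'X) * orbit_poly y.
Proof.
elim/freemod_ind: y => [|y y' h h'|k y h|t].
- by rewrite [edges_act _ _]edges_act0 !orbit_poly0 mulr0.
- by rewrite edges_actD !orbit_polyD h h' mulrDr.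
- by rewrite edges_actZ !orbit_polyZ h scalerAr.
have [ts|n] := eqVneq (last v (map tgt s)) (tsrc t).
  have [t' [t'E _ ->]] := edges_act_delta hq s_chain ts.
  by rewrite orbit_polyZ !orbit_polyU (orbit_monomial_cat t'E) scalerAl.
rewrite (edges_act_delta0 hq s0 s_chain n) orbit_poly0 orbit_polyU.
rewrite orbit_monomial0 ?mulr0 // => m /orbit_src tv.
by rewrite s_last tv eqxx in n.
Qed.

(** The polynomial p(kappa X), since s acts on orbit polynomials as kappa X. *)
Definition scaled_poly (p : {poly K}) : {poly F} :=
  \poly_(j < size p) (quot_field_in hq p`_j * kappa ^+ j).

Lemma orbit_poly_lincomb k (a : 'I_k -> K) (y : 'I_k -> C) :
  orbit_poly (\sum_i a i *: (y i : N) : N) =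
  \sum_i quot_field_in hq (a i) *: orbit_poly (y i).
Proof.
rewrite [LHS](big_morph orbit_poly orbit_polyD orbit_poly0).
by apply: eq_bigr => i _; apply: orbit_polyZ.
Qed.

Lemma orbit_poly_act (p : {poly K}) (y : C) :
  orbit_poly (poly_act p s (y : N)) = scaled_poly p * orbit_poly y.
Proof.
rewrite /poly_act [LHS](linear_sum orbit_poly) /scaled_poly poly_def mulr_suml.
apply: eq_bigr => j _.
rewrite [LHS](orbit_polyZ (quot_field_in hq p`_j)) -scalerA -scalerAl.
congr (_ *: _); elim: (j : nat) => [|k IH].
  by rewrite !expr0 scale1r mul1r.
rewrite iterS orbit_poly_edges IH !exprS mulrA; congr (_ * _).
by rewrite -scalerAl -scalerAr scalerA.
Qed.

End Orbit.

Lemma seq_weight_neq0 (K : fieldType) (E : graph) (e : gcycle E) (q : {poly K})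
  (hq : basic_irreducible q) s : seq_weight e hq s != 0.
Proof.
rewrite /seq_weight prodf_seq_neq0; apply/allP => f _ /=; rewrite /edge_weight.
by case: (f == _); rewrite ?xbar_neq0 ?oner_eq0.
Qed.

Section Independence.
Variables (K : fieldType) (E : graph) (e : gcycle E).
Variables (p q : {poly K}) (hp : basic_irreducible p) (hq : basic_irreducible q).
Local Notation F := (quot_field hq).
Local Notation N := (chen_poly hq e).
Variables (v : vert E) (s : seq (edge E)).
Hypothesis s0 : s != [::].
Hypothesis s_chain : chain v s.
Hypothesis s_last : last v (map tgt s) = v.

Lemma size_scaled_poly : size (scaled_poly e hq s p) = size p.
Proof.
have [[sp _] _ _] := hp.
have p0 : lead_coef p != 0 by rewrite lead_coef_eq0 -size_poly_gt0 ltnW.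
apply: size_poly_eq.
by rewrite mulf_neq0 ?expf_neq0 ?seq_weight_neq0 // fmorph_eq0 -lead_coefE.
Qed.

(** If the combination is P y, its orbit polynomial at r_i, which is the
    constant a_i lead_coef p, is a multiple of [scaled_poly], whose degree is
    deg p > 0; so it vanishes. *)
Lemma delta_indep k (r : 'I_k -> tail_class e) :
  injective r -> (forall i, tsrc (r i) = v) ->
  (forall i x, tval (r i) <> inf_cat e s x) ->
  forall (a : 'I_k -> K) (y : N),
  \sum_i a i *: (lead_coef p *: (delta F (r i) : N)) = poly_act p s y ->
  forall i, a i = 0.
Proof.
move=> r_inj r_src r_root a y aE i.
have [[sp _] dp _] := hp.
have /(congr1 (orbit_poly s (r i))) := aE.
rewrite (orbit_poly_act s0 s_chain s_last (r_src i) (r_root i)).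
under eq_bigr do rewrite scalerA.
rewrite (orbit_poly_lincomb s (r i) (fun j => a j * lead_coef p)).
rewrite (bigD1 i) //= big1 => [|j ji]; last first.
  rewrite orbit_polyU orbit_monomial0 ?scaler0 // => -[|m] h.
    by case/eqP: ji; apply/r_inj/val_inj.
  exact: r_root h.
have r0 : on_orbit s (r i) 0 (r i) by [].
rewrite addr0 orbit_polyU (orbit_monomialE hq (r_root i) r0) expr0 alg_polyC.
move=> h; have : quot_field_in hq (a i * lead_coef p) = 0.
  have [y0|y0] := eqVneq (orbit_poly s (r i) y) 0.
    by apply/polyC_inj; rewrite h y0 mulr0.
  have := size_polyC_leq1 (quot_field_in hq (a i * lead_coef p)).
  rewrite h size_mul // -?size_poly_gt0 size_scaled_poly //; last exact: ltnW.
  move: y0; rewrite -size_poly_gt0; move: (size (orbit_poly _ _ _)) => m.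
  by case: (size p) m dp => [|[|[|n]]] [|m].
move/eqP; rewrite fmorph_eq0 mulf_eq0 lead_coef_eq0 -size_poly_eq0.
by case: (size p) dp => // ? _; rewrite orbF => /eqP.
Qed.

End Independence.

(** * Infinitely many infinite paths that do not start with c *)

Section Walks.
Variable E : graph.
Implicit Types (u v w : vert E) (s t c d : seq (edge E)).

Definition walk u v s := chain u s && (last u (map tgt s) == v).

Lemma walk_cat u v w s t : walk u v s -> walk v w t -> walk u w (s ++ t).
Proof.
by rewrite /walk chain_cat map_cat last_cat => /andP[-> /eqP ->].
Qed.

Lemma walk_catr u v w s t : walk u v s -> walk u w (s ++ t) -> walk v w t.
Proof.
rewrite /walk chain_cat map_cat last_cat => /andP[-> /eqP ->].
exact: id.
Qed.

Lemma walk_pow u s n : walk u u s -> walk u u (flatten (nseq n s)).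
Proof.
move=> us; elim: n => [|n IH] /=; first by rewrite /walk /= eqxx.
exact: walk_cat us IH.
Qed.

Lemma walk_cycle (c : gcycle E) : walk (cbase c) (cbase c) (cseq c).
Proof. by rewrite /walk cycle_chain cycle_last eqxx. Qed.

Lemma walk_gpath (l : gpath E) : walk (psrc l) (ptgt l) (pedges l).
Proof. by rewrite /walk eqxx andbT; apply: (pvalP l). Qed.

Definition incomparable s t := ~~ prefix s t && ~~ prefix t s.

Lemma incomparable_catl r s t :
  incomparable (r ++ s) (r ++ t) = incomparable s t.
Proof. by elim: r => //= f r IH; rewrite /incomparable /= eqxx. Qed.

Lemma prefix_comparable r s t : prefix s r -> prefix t r -> ~~ incomparable s t.
Proof.
rewrite negb_and !negbK.
elim: r s t => [|f r IH] [|g s] [|h t] //=; rewrite ?orbT //.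
by move=> /andP[/eqP-> sr] /andP[/eqP-> tr]; rewrite eqxx IH.
Qed.

(** Two incomparable paths cannot both follow c forever.  As long as both are
    comparable with c, they both start with it: if one of them were a prefix
    of c, it would be comparable with the other.  Removing the common turn
    around c keeps them incomparable. *)
Lemma incomparable_drop v u c s t : walk v v c -> c != [::] ->
  walk v u s -> walk v u t -> incomparable s t ->
  exists2 r, walk v u r & incomparable c r.
Proof.
move=> cv c0; have [n] := ubnP (size s).
elim: n s t => // n IH s t sn sv tv st.
have [|sc] := boolP (incomparable c s); first by exists s.
have [|tc] := boolP (incomparable c t); first by exists t.
move: sc tc; rewrite !negb_and !negbK => /orP[]cs /orP[]ct.
- case/prefixP: cs sn sv st => s' -> sn sv; case/prefixP: ct tv => t' -> tv.
  rewrite incomparable_catl; apply: IH (walk_catr cv sv) (walk_catr cv tv).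
  move: sn; rewrite ltnS size_cat; apply: leq_trans.
  by rewrite -[X in (X < _)%N]add0n ltn_add2r; case: (c) c0.
- by case/andP: st => _; rewrite (prefix_trans ct cs).
- by case/andP: st; rewrite (prefix_trans cs ct).
- by move: (prefix_comparable cs ct); rewrite st.
Qed.

(** A cycle returns to its base vertex only at its end, so it is not a proper
    initial part of another cycle based there. *)
Lemma cycle_prefix u s t : walk u u s -> walk u u t -> uniq (map src t) ->
  s != [::] -> prefix s t -> s = t.
Proof.
move=> us ut + s0 /prefixP[t' tE]; rewrite tE in ut *.
have /andP[+ _] := walk_catr us ut; case: t' {ut tE} => [|f t'] /=.
  by rewrite cats0.
case: s s0 us => //= g s _ /andP[/andP[/eqP gu _] _] /andP[/eqP fu _].
by rewrite map_cat mem_cat /= gu -fu inE eqxx !orbT.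
Qed.

Lemma cycle_incomparable u s t : walk u u s -> walk u u t ->
  uniq (map src s) -> uniq (map src t) -> s != [::] -> t != [::] -> s != t ->
  incomparable s t.
Proof.
move=> us ut ss st s0 t0 n; apply/andP; split; apply: contra n => h.
  by rewrite (cycle_prefix us ut st s0 h).
by rewrite (cycle_prefix ut us ss t0 h).
Qed.

(** The two cycles are the rotation of c at u and another cycle based at u. *)
Lemma nonexclusive_cycles (c : gcycle E) : ~ exclusive c ->
  exists u d1 d2, [/\ walk u u d1, walk u u d2, incomparable d1 d2,
    (exists s, walk (cbase c) u s) & (exists s, walk u (cbase c) s)].
Proof.
move=> nexcl; apply: contrapT => h; apply: nexcl => u uc d du.
apply: contrapT => dc; apply: h.
pose k := index u (map src (cseq c)).
have kc : (k < size (cseq c))%N by rewrite -(size_map src) index_mem.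
have catE : take k (cseq c) ++ drop k (cseq c) = cseq c by rewrite cat_take_drop.
have w1 : walk (cbase c) u (take k (cseq c)).
  have := cycle_chain c; rewrite -[X in chain _ X]catE chain_cat => /andP[cc].
  rewrite (drop_nth (chead c) kc) /= => /andP[/eqP fk _].
  by rewrite /walk cc -fk -(nth_map (chead c) (cbase c) src kc) nth_index /=.
have w2 : walk u (cbase c) (drop k (cseq c)).
  by apply: (walk_catr w1); rewrite catE; apply: walk_cycle.
have dw := walk_cycle d; rewrite du in dw.
have rw : walk u u (rot k (cseq c)) by rewrite /rot; apply: walk_cat w2 w1.
exists u, (cseq d), (rot k (cseq c)); split => //.
- apply: (cycle_incomparable dw rw) => //.
  + by have /and3P[] := gcycleP d.
  + by rewrite map_rot rot_uniq; have /and3P[] := gcycleP c.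
  + by rewrite -size_eq0 size_rot.
  + exact/eqP.
- by exists (take k (cseq c)).
- by exists (drop k (cseq c)).
Qed.

Lemma walk_tail (e : gcycle E) u s : walk u (cbase e) s ->
  exists q : tail_class e, tval q = inf_cat e s (einf e) /\ tsrc q = u.
Proof.
move=> /andP[cs /eqP ls].
have h : `[< tail_eq e (inf_cat e s (einf e)) >].
  by apply/asboolP; exists (@GPath E (u, s) cs).
exists (TailClass h); split => //; rewrite /tsrc /=.
by case: s cs ls {h} => [_ /= ->|f s /= /andP[/eqP <- _] _].
Qed.

(** One of the two cycles at u leads away from c, and any word in the two cycles
    can follow.  The paths share the initial part that leaves c, so none of them
    starts with c. *)
Lemma independent_tails (c e : gcycle E) :
  (exists mu : gpath E, psrc mu = cbase c /\ ptgt mu = cbase e) ->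
  ~ (exclusive c /\ exclusive e) ->
  exists r : nat -> tail_class e,
    [/\ injective r, forall i, tsrc (r i) = cbase c &
      forall i x, tval (r i) <> inf_cat e (cseq c) x].
Proof.
move=> [mu [mu_src mu_tgt]] nexcl.
have mw := walk_gpath mu; rewrite mu_src mu_tgt in mw.
have [u [d1 [d2 [d1u d2u d12 [s su] [t tu]]]]] : exists u d1 d2,
    [/\ walk u u d1, walk u u d2, incomparable d1 d2,
    (exists s, walk (cbase c) u s) & (exists s, walk u (cbase e) s)].
  have [ec|/nonexclusive_cycles] := pselect (exclusive c); last first.
    move=> [u [d1 [d2 [d1u d2u d12 su [t tu]]]]]; exists u, d1, d2; split=> //.
    by exists (t ++ pedges mu); apply: walk_cat tu mw.
  have /nonexclusive_cycles [u [d1 [d2 [d1u d2u d12 [s su] tu]]]] : ~ exclusive e.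
    by move=> ee; apply: nexcl.
  exists u, d1, d2; split=> //.
  by exists (pedges mu ++ s); apply: walk_cat mw su.
have [l lu cl] : exists2 l, walk (cbase c) u l & incomparable (cseq c) l.
  have [sd1 sd2] := (walk_cat su d1u, walk_cat su d2u).
  apply: (incomparable_drop (walk_cycle c) _ sd1 sd2) => //.
  by rewrite incomparable_catl.
(* The detour d2 makes the number i of turns around d1 readable from the
   infinite path, even when d1^oo is tail equivalent to e^oo. *)
pose q i := l ++ flatten (nseq i d1) ++ d2 ++ t.
have qw i : walk (cbase c) (cbase e) (q i).
  exact: walk_cat lu (walk_cat (walk_pow i d1u) (walk_cat d2u tu)).
have [r rq] := choice (fun i => walk_tail (qw i)).
exists r; split=> [i j|i|i x].
- have r_lt i' j' : (i' < j')%N -> r i' <> r j'.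
    move=> ij /(congr1 (@tval _ e)); rewrite !(proj1 (rq _)) /q.
    rewrite -(subnK (ltnW ij)) addnC nseqD flatten_cat -!catA.
    rewrite ![inf_cat e (l ++ _) _]inf_cat_cat => /inf_cat_inj.
    rewrite ![inf_cat e (flatten (nseq i' d1) ++ _) _]inf_cat_cat => /inf_cat_inj.
    move: (ij); rewrite -subn_gt0; case: (j' - i')%N => // m _.
    rewrite /= -catA ![inf_cat e (d2 ++ _) _]inf_cat_cat.
    rewrite [inf_cat e (d1 ++ _) _]inf_cat_cat => /inf_cat_prefix.
    by move: d12; rewrite /incomparable -negb_or orbC => /negbTE->.
  move=> rij; case: (ltngtP i j) => // h; first by case: (r_lt _ _ h).
  by case: (r_lt _ _ h).
- exact: (proj2 (rq i)).
- rewrite (proj1 (rq i)) /q inf_cat_cat => /inf_cat_prefix.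
  by move: cl; rewrite /incomparable -negb_or orbC => /negbTE->.
Qed.

End Walks.

(** * The theorem *)

Theorem theorem5p3 (K : fieldType) (E : graph) (c e : gcycle E) (p q : {poly K})
  (hp : basic_irreducible p) (hq : basic_irreducible q)
  (hpath : exists mu : gpath E, psrc mu = cbase c /\ ptgt mu = cbase e)
  (hexcl : ~ (exclusive c /\ exclusive e)) :
  ext1_infinite_dim (chen_poly hp c) (chen_poly hq e).
Proof.
move=> k; have [r [r_inj r_src r_root]] := independent_tails hpath hexcl.
pose n (i : 'I_k) : chen_poly hq e := delta (quot_field hq) (r i).
have n_src i : act (lpa_vert K (cbase c)) (n i) = n i.
  by rewrite chen_poly_vert r_src eqxx.
exists (fun i => head_ext hp (n_src i)).
apply: ext_lin_indepI (poly_act_tinf c hp) (fun i => head_ext_connects hp (n_src i)) _.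
apply: (delta_indep hp _ (cycle_chain c) (cycle_last c)) => //.
by move=> i j /r_inj /val_inj.
Qed.
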